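(* Let $\Phi$ be the completely positive map with Kraus operators $A_1,\dots,A_p\in\mathbb{C}^{m\times n}$ having integer entries of absolute value at most $M$, and let $(L^*,R^* )$ be its dominant independent set, $k^*$ its noncommutative rank and $r^*=\dim R^*$. There is an absolute constant $c>0$ such that the following holds: if $(L,R)$ is an $\varepsilon$-independent set for $\Phi$ that violates $(k^*,r^*+1)$ and $\varepsilon\le \varepsilon_0 := \exp(-c(n(n+m)\log(m+n)+n\log M))$, then $\|\pi_L-\pi_{L^*}\|_2,\ \|\pi_R-\pi_{R^*}\|_2 \le \exp\big(c(n^2(n+m)\log(m+n)+n^2\log(Mp))\big)\,\varepsilon$.
   Context: $\pi_S$ denotes the orthogonal projection onto a subspace $S$ and $\|\cdot\|_2$ the operator norm. Subspaces $L\subseteq\mathbb{C}^m$, $R\subseteq\mathbb{C}^n$ form an independent set if $x^\dagger A_iy=0$ for all $x\in L,y\in R,i$, and an $\varepsilon$-independent set if $|x^\dagger A_i y|\le\varepsilon\|x\|\|y\|$ for all $x\in L,y\in R,i$. The maximum of $\dim L+\dim R$ over independent sets is $m+n-k^*$ with $k^*=\operatorname{ncrank}\operatorname{span}\{A_i\}$; the dominant independent set $(L^*,R^* )$ is the unique maximum-size independent set with $L^*$ maximal and $R^*$ minimal. A pair $(L,R)$ violates $(k,r)$ if $\dim L+\dim R>m+n-k$, or $\dim L+\dim R=m+n-k$ and $\dim R<r$. *)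

(* Defs.v *)
From HB Require Import structures.
From mathcomp Require Import all_boot all_order all_algebra.
From mathcomp Require Import sesquilinear spectral.
From mathcomp Require Import all_classical all_reals.
From mathcomp Require Import complex.

Set Implicit Arguments.
Unset Strict Implicit.
Unset Printing Implicit Defensive.
Import Order.TTheory GRing.Theory Num.Theory.

Local Open Scope ring_scope.
Local Open Scope sesquilinear_scope.
Local Open Scope classical_set_scope.

(* dotcv u v = v^* u: the library's dotmx is for row vectors only. *)
Section DotColumn.
Variables (C : numClosedFieldType) (n : nat).

Local Notation dotcv_def :=
  (@form_of_matrix C 1 Num.conj n (mx_of_hermitian (hermitian1mx 1))).

Definition dotcv (u v : 'cV[C]_n) : C := dotcv_def u v.

HB.instance Definition _ := Bilinear.copy dotcv dotcv_def.
HB.instance Definition _ := Hermitian.copy dotcv dotcv_def.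

Lemma dotcvE u v : dotcv u v = (v ^t* *m u) 0 0.
Proof. by rewrite /dotcv /form_of_matrix mulmx1 mxtrace_mulC trace_mx11. Qed.

Lemma dotcv_gt0 u : u != 0 -> 0 < dotcv u u.
Proof.
move=> u_neq0; rewrite dotcvE mxE.
suff /existsP[i ui_neq0] : [exists i, u i 0 != 0].
  rewrite (bigD1 i) //= ltr_wpDr// ?sumr_ge0// => [j _|]; rewrite !mxE mulrC.
    by rewrite mul_conjC_ge0.
  by rewrite mul_conjC_gt0.
apply: contraNT u_neq0; rewrite negb_exists => /forallP u0.
by apply/eqP/colP => j; rewrite mxE; apply/eqP; rewrite -[_ == _]negbK u0.
Qed.

HB.instance Definition _ := isDotProduct.Build C _ dotcv dotcv_gt0.

Definition orthcompl (L : {vspace 'cV[C]_n}) : {vspace 'cV[C]_n} :=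
  orthov dotcv L.

Definition orthproj (L : {vspace 'cV[C]_n}) : 'End('cV[C]_n) :=
  daddv_pi L (orthcompl L).

(* daddv_pi is a projection only along a complementary subspace. *)
Lemma orthcompl_cap L : (L :&: orthcompl L = 0)%VS.
Proof.
apply/eqP; rewrite -subv0; apply/subvP => v; rewrite memv_cap memv0.
case/andP=> vL /mem_orthovP/(_ v vL) v0; apply/negPn/negP => /dotcv_gt0.
by rewrite v0 ltxx.
Qed.

Lemma orthcompl_add L : (L + orthcompl L = fullv)%VS.
Proof.
apply/vspaceP => v; rewrite memvf.
have [X XL [Y [-> _ XY]]] := orthogonal_split dotcv (vbasis L) v.
rewrite memv_add //; first by rewrite -(span_basis (vbasisP L)).
apply/mem_orthovP => u; rewrite -(span_basis (vbasisP L)).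
by apply: span_orthogonal XY _; rewrite memv_span ?mem_head.
Qed.

Lemma orthprojP L v :
  orthproj L v \in L /\ (forall u, u \in L -> dotcv (v - orthproj L v) u = 0).
Proof.
split; first exact: memv_pi.
apply/mem_orthovP; have vLL : v \in (L + orthcompl L)%VS.
  by rewrite orthcompl_add memvf.
by rewrite -{1}(daddv_pi_add (orthcompl_cap L) vLL) addrC addKr memv_pi.
Qed.

End DotColumn.

Section Norms.
Variable K : realType.
Local Notation C := K[i].
Local Notation normc := (@Normc.normc K).

Definition l2norm n (v : 'cV[C]_n) : K :=
  Num.sqrt (\sum_i normc (v i 0) ^+ 2).

Definition opnorm n m (f : 'Hom('cV[C]_n, 'cV[C]_m)) : K :=
  sup [set l2norm (f v) | v in [set v | l2norm v <= 1]].

(* sup of an unbounded set would be 0. *)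
Lemma opnorm_has_sup n m (f : 'Hom('cV[C]_n, 'cV[C]_m)) :
  has_sup [set l2norm (f v) | v in [set v | l2norm v <= 1]].
Proof.
have normc_ge0 (z : C) : 0 <= normc z by case: z => a b; exact: sqrtr_ge0.
split.
  exists (l2norm (f 0)), 0 => //=; rewrite /l2norm big1 ?sqrtr0 // => i _.
  by rewrite mxE (Normc.normc0 K) expr0n.
pose F i j := normc (f (delta_mx j 0) i 0).
exists (Num.sqrt (\sum_i (\sum_j F i j) ^+ 2)) => _ [v /= v1 <-].
apply: ler_wsqrtr; apply: ler_sum => i _.
rewrite lerXn2r ?nnegrE ?sumr_ge0 // => [j _|]; first exact: normc_ge0.
have vj1 j : normc (v j 0) <= 1.
  rewrite -(@ler_pXn2r _ 2) ?nnegrE // expr1n.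
  have S0 : 0 <= \sum_i normc (v i 0) ^+ 2.
    by apply: sumr_ge0 => k _; exact: sqr_ge0.
  have : (l2norm v) ^+ 2 <= 1 by rewrite expr_le1 // sqrtr_ge0.
  rewrite sqr_sqrtr //; apply: le_trans.
  by rewrite (bigD1 j) //= lerDl sumr_ge0 // => k _; exact: sqr_ge0.
have -> : f v i 0 = \sum_j v j 0 * f (delta_mx j 0) i 0.
  rewrite {1}[v]matrix_sum_delta linear_sum summxE; apply: eq_bigr => j _.
  by rewrite big_ord1 linearZ mxE.
have: normc (\sum_j v j 0 * f (delta_mx j 0) i 0)
    <= \sum_j normc (v j 0 * f (delta_mx j 0) i 0).
  exact: (@ler_norm_sum K (Rcomplex K)).
move/le_trans; apply; apply: ler_sum => j _.
by rewrite Normc.normcM ler_piMl.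
Qed.

End Norms.

Section IndependentSets.
Variables (K : realType) (m n : nat).
Local Notation C := K[i].
Implicit Types (L : {vspace 'cV[C]_m}) (R : {vspace 'cV[C]_n}).

Definition indep_space (S : {vspace 'M[C]_(m, n)}) L R : Prop :=
  forall B x y, B \in S -> x \in L -> y \in R -> (x ^t* *m B *m y) 0 0 = 0.

(* By a theorem of Fortin and Reutenauer this is the rank over the free skew
   field of sum_i x_i B_i, for noncommuting x_i and B_i spanning S. *)
Definition ncrank (S : {vspace 'M[C]_(m, n)}) : nat :=
  m + n - \max_(s < (m + n).+1 |
            `[< exists L R, indep_space S L R /\ (\dim L + \dim R)%N = s >]) s.

Section Family.
Variables (p : nat) (A : 'I_p -> 'M[C]_(m, n)).

Definition indep L R : Prop :=
  forall i x y, x \in L -> y \in R -> (x ^t* *m A i *m y) 0 0 = 0.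

Definition eps_indep (eps : K) L R : Prop :=
  forall i x y, x \in L -> y \in R ->
    Normc.normc ((x ^t* *m A i *m y) 0 0) <= eps * l2norm x * l2norm y.

Definition max_indep L R : Prop :=
  indep L R /\
  (forall L' R', indep L' R' -> (\dim L' + \dim R' <= \dim L + \dim R)%N).

Definition dominant L R : Prop :=
  [/\ max_indep L R,
      forall L' R', max_indep L' R' -> (L <= L')%VS -> L' = L
    & forall L' R', max_indep L' R' -> (R' <= R)%VS -> R' = R].

End Family.

(* k is moved to the left-hand sides to avoid truncated subtraction. *)
Definition violates (k r : nat) L R : Prop :=
  (m + n < \dim L + \dim R + k)%N \/
  (\dim L + \dim R + k = m + n)%N /\ (\dim R < r)%N.

End IndependentSets.

(* Main.v *)
(* The pair (L, R) is turned into exact data by the geometry of numbers.  Stretch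
   the lattice Z[i]^n by 1/eps transversally to R and reduce it: this gives
   independent Gaussian-integer vectors y_0, y_1, ... of stretched lengths
   mu_0 <= mu_1 <= ... whose product is at most 2^C(n,2) eps^-(n - dim R).
   Let V_j be the span of all A_i y_l with l < j.  The orthogonal complement of
   V_j and the span Y_j of the y_l with l < j form an independent pair, so
   maximality of the dominant pair (Ls, Rs) bounds dim V_j from below, with one
   more dimension as long as Y_j does not contain Rs.  Choose as many independent
   integral vectors among the A_i y_l as these bounds allow: their Gram volume is
   at least 1, whereas by eps-independence their components along L are small.
   Comparing the two shows that the mu_j left over are at most a constant q; in
   particular mu_j <= q for j < r = dim Rs, and Rs must be equal to Y_r.  Hence
   Rs has an integral basis lying within eps q of R, and V_r, the orthogonal
   complement of Ls, has an integral basis almost orthogonal to L.  Cramer's rule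
   with integral determinants makes both statements uniform on unit vectors, and
   equality of dimensions makes them symmetric.  If the asserted bound exceeds 2
   there is nothing to prove, which supplies all smallness conditions on eps;
   eps = 0 is a limiting case. *)

Require Import Defs.
From HB Require Import structures.
From mathcomp Require Import all_boot all_order all_algebra.
From mathcomp Require Import perm sesquilinear spectral ring lra zify.
From mathcomp Require Import all_classical all_reals sequences exp.
From mathcomp Require Import complex.

Set Implicit Arguments.
Unset Strict Implicit.
Unset Printing Implicit Defensive.
Import Order.TTheory GRing.Theory Num.Theory.
Local Open Scope ring_scope.
Local Open Scope sesquilinear_scope.

(** * Hermitian norms *)

Section Modulus.
Variable K : realType.
Local Notation C := K[i].
Local Notation nc := (@Normc.normc K).
Implicit Types z w : C.

Lemma nc_norm z : (nc z)%:C%C = `|z|. Proof. by []. Qed.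

Lemma nc_ge0 z : 0 <= nc z.
Proof. by case: z => a b; exact: sqrtr_ge0. Qed.

Lemma nc_sum (I : Type) (r : seq I) (P : pred I) (F : I -> C) :
  nc (\sum_(i <- r | P i) F i) <= \sum_(i <- r | P i) nc (F i).
Proof. exact: (@ler_norm_sum K (Rcomplex K)). Qed.

Lemma nc_prod (I : Type) (r : seq I) (P : pred I) (F : I -> C) :
  nc (\prod_(i <- r | P i) F i) = \prod_(i <- r | P i) nc (F i).
Proof.
by elim/big_rec2: _ => [|i x y _ <-]; rewrite ?(Normc.normc1 K) ?Normc.normcM.
Qed.

Lemma nc_conj z : nc z^* = nc z.
Proof. by apply: (@complexI K); rewrite !nc_norm norm_conjC. Qed.

Lemma nc_sqr z : (nc z ^+ 2)%:C%C = z^* * z.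
Proof. by rewrite rmorphXn /= nc_norm normCKC. Qed.

Lemma nc_real (x : K) : nc x%:C%C = `|x|.
Proof. by rewrite /= expr0n addr0 sqrtr_sqr. Qed.

Lemma nc_eq0 z : (nc z == 0) = (z == 0).
Proof.
apply/eqP/eqP => [|->]; first exact: Normc.eq0_normc.
exact: (Normc.normc0 K).
Qed.

End Modulus.

Section L2Norm.
Variable K : realType.
Local Notation C := K[i].
Local Notation nc := (@Normc.normc K).

Lemma l2norm_ge0 n (v : 'cV[C]_n) : 0 <= l2norm v.
Proof. exact: sqrtr_ge0. Qed.

Lemma l2norm_sqr n (v : 'cV[C]_n) : l2norm v ^+ 2 = \sum_i nc (v i 0) ^+ 2.
Proof. by rewrite sqr_sqrtr // sumr_ge0 // => i _; exact: sqr_ge0. Qed.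

Lemma l2norm_dot n (v : 'cV[C]_n) : (l2norm v ^+ 2)%:C%C = dotcv v v.
Proof.
rewrite l2norm_sqr rmorph_sum dotcvE mxE; apply: eq_bigr => i _.
by rewrite /= nc_sqr !mxE.
Qed.

Lemma l2norm_eq0 n (v : 'cV[C]_n) : (l2norm v == 0) = (v == 0).
Proof.
have [->|v0] := eqVneq v 0.
  by rewrite /l2norm big1 ?sqrtr0 ?eqxx // => i _;
    rewrite mxE Normc.normc0 expr0n.
apply/negbTE/eqP => lv0; have := dotcv_gt0 v0.
by rewrite -l2norm_dot lv0 expr0n ltxx.
Qed.

Lemma l2norm0 n : l2norm (0 : 'cV[C]_n) = 0.
Proof. by apply/eqP; rewrite l2norm_eq0. Qed.

Lemma l2normZ n a (v : 'cV[C]_n) : l2norm (a *: v) = nc a * l2norm v.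
Proof.
apply/(@pexpIrn _ 2); rewrite ?nnegrE ?mulr_ge0 ?nc_ge0 ?l2norm_ge0 //.
rewrite exprMn !l2norm_sqr mulr_sumr; apply: eq_bigr => i _.
by rewrite mxE Normc.normcM exprMn.
Qed.

Lemma l2normN n (v : 'cV[C]_n) : l2norm (- v) = l2norm v.
Proof. by rewrite -scaleN1r l2normZ normcN (Normc.normc1 K) mul1r. Qed.

Lemma l2norm_CS n (u v : 'cV[C]_n) : nc (dotcv u v) <= l2norm u * l2norm v.
Proof.
rewrite -(@ler_pXn2r _ 2) ?nnegrE ?mulr_ge0 ?nc_ge0 ?l2norm_ge0 //.
rewrite -lecR exprMn [leRHS]rmorphM [leLHS]rmorphXn /= !l2norm_dot nc_norm.
by have [] := CauchySchwarz (@dotcv C n) u v.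
Qed.

Lemma dotcv_conj n (u v : 'cV[C]_n) : dotcv v u = (dotcv u v)^*.
Proof. by rewrite hermC expr0 mul1r. Qed.

Lemma l2normD_sqr n (u v : 'cV[C]_n) :
  l2norm (u + v) ^+ 2 =
    l2norm u ^+ 2 + l2norm v ^+ 2 + 2 * complex.Re (dotcv u v).
Proof.
apply: (@complexI K); rewrite !rmorphD /= !l2norm_dot dnormD; congr (_ + _).

by rewrite rmorphM rmorph_nat; exact: addcJ.
Qed.

Lemma l2normD n (u v : 'cV[C]_n) : l2norm (u + v) <= l2norm u + l2norm v.
Proof.
rewrite -(@ler_pXn2r _ 2) ?nnegrE ?addr_ge0 ?l2norm_ge0 //.
have Re_le : complex.Re (dotcv u v) <= l2norm u * l2norm v.
  apply: le_trans (l2norm_CS u v); rewrite -lecR.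
  by apply: le_trans (normc_ge_Re _); rewrite lecR ler_norm.
by rewrite l2normD_sqr; lra.
Qed.

Lemma l2norm_sum n (I : Type) (r : seq I) (P : pred I) (F : I -> 'cV[C]_n) :
  l2norm (\sum_(i <- r | P i) F i) <= \sum_(i <- r | P i) l2norm (F i).
Proof.
elim/big_rec2: _ => [|i x y _ le_yx]; first by rewrite l2norm0.
by apply: le_trans (l2normD _ _) _; rewrite lerD2l.
Qed.

Lemma l2normD_orth n (u v : 'cV[C]_n) :
  dotcv u v = 0 -> l2norm (u + v) ^+ 2 = l2norm u ^+ 2 + l2norm v ^+ 2.
Proof.
by move=> uv0; apply: (@complexI K); rewrite rmorphD /= !l2norm_dot hnormDd.
Qed.

Lemma l2norm_coord n (v : 'cV[C]_n) i : nc (v i 0) <= l2norm v.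
Proof.
rewrite -(@ler_pXn2r _ 2) ?nnegrE ?nc_ge0 ?l2norm_ge0 // l2norm_sqr.
by rewrite (bigD1 i) //= lerDl sumr_ge0 // => j _; exact: sqr_ge0.
Qed.

Lemma dotcvDl n (u v w : 'cV[C]_n) : dotcv (u + v) w = dotcv u w + dotcv v w.
Proof. exact: linearDl. Qed.

Lemma dotcvDr n (u v w : 'cV[C]_n) : dotcv u (v + w) = dotcv u v + dotcv u w.
Proof. exact: linearDr. Qed.

Lemma dotcvBl n (u v w : 'cV[C]_n) : dotcv (u - v) w = dotcv u w - dotcv v w.
Proof. exact: linearBl. Qed.

Lemma dotcvBr n (u v w : 'cV[C]_n) : dotcv u (v - w) = dotcv u v - dotcv u w.
Proof. exact: linearBr. Qed.

Lemma dotcv_mxl m n (B : 'M[C]_(m, n)) x y :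
  dotcv (B *m y) x = dotcv y (B ^t* *m x).
Proof. by rewrite !dotcvE trmx_mul map_mxM trmxCK mulmxA. Qed.

Lemma l2norm_isometry m n (W : 'M[C]_(m, n)) (v : 'cV[C]_n) :
  W ^t* *m W = 1%:M -> l2norm (W *m v) = l2norm v.
Proof.
move=> WW; apply/(@pexpIrn _ 2); rewrite ?nnegrE ?l2norm_ge0 //.
by apply: (@complexI K); rewrite !l2norm_dot dotcv_mxl mulmxA WW mul1mx.
Qed.

End L2Norm.

(** * Gaussian integers and volumes *)

Section GaussianIntegers.
Variable K : realType.
Local Notation C := K[i].
Local Notation nc := (@Normc.normc K).

(** Gaussian integers are used because the reduction subtracts complex multiples of lattice vectors
    and Gram matrices involve conjugation. *)
Definition gint_pred (z : C) :=
  (complex.Re z \is a Num.int) && (complex.Im z \is a Num.int).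
Definition gint := [qualify a z | gint_pred z].

Fact gint_subring : subring_closed gint.
Proof.
split=> [|[a b] [c d] /andP[/= aZ bZ] /andP[/= cZ dZ]|
          [a b] [c d] /andP[/= aZ bZ] /andP[/= cZ dZ]].
- by rewrite qualifE /gint_pred /= rpred1 rpred0.
- by rewrite qualifE /gint_pred /= !rpredB.
- by rewrite qualifE /gint_pred /= rpredB ?rpredD ?rpredM.
Qed.
HB.instance Definition _ := GRing.isSubringClosed.Build C gint_pred
  gint_subring.

(** The squared modulus is a sum of two integer squares, not both zero. *)
Lemma gint_norm_ge1 z : z \is a gint -> z != 0 -> 1 <= nc z.
Proof.
case: z => a b /andP[/= aZ bZ] ab0; rewrite -sqrtr1 ler_wsqrtr //.
have sqr_ge1 (x : K) : x \is a Num.int -> x != 0 -> 1 <= x ^+ 2.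
  move=> xZ x0; rewrite -real_normK ?num_real //.
  by rewrite exprn_ege1 // norm_intr_ge1.
have [a0|a0] := eqVneq a 0; last first.
  by rewrite -[leLHS]addr0 lerD ?sqr_ge0 ?sqr_ge1.
rewrite a0 expr0n add0r sqr_ge1 //.
by apply: contraNneq ab0 => ->; rewrite a0.
Qed.

Lemma gint_conj z : (z^* \is a gint) = (z \is a gint).
Proof. by case: z => a b; rewrite !qualifE /gint_pred /= rpredN. Qed.

Lemma gint_int (x : int) : (x%:~R : C) \is a gint.
Proof. exact: rpred_int. Qed.

(** Rounding each coordinate costs at most 1/2, hence 1/4 + 1/4 in the square. Here [s] is the
    negative of the rounded number. *)
Lemma gint_round (w : C) : exists2 s, s \is a gint & nc (w + s) ^+ 2 <= 1 / 2.
Proof.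
case: w => a b.
pose r (x : K) : K := (Num.floor (x + 1 / 2))%:~R.
have r_le x : (x + - r x) ^+ 2 <= 1 / 4.
  have /andP[] := floor_itv (x + 1 / 2); rewrite -/(r x) intrD -/(r x) => h1 h2.
  by nra.
exists (Complex (- r a) (- r b)).
  by rewrite qualifE /gint_pred /= !rpredN !intr_int.
by rewrite /= sqr_sqrtr ?addr_ge0 ?sqr_ge0 //; have := r_le a; have := r_le b;
  lra.
Qed.

Lemma gint_det n (Z : 'M[C]_n) : Z \is a mxOver gint -> \det Z \is a gint.
Proof.
move=> /mxOverP Zg; apply: rpred_sum => s _; apply: rpredM.
  by rewrite rpredX // rpredN rpred1.
by apply: rpred_prod.
Qed.

Lemma l2norm_gint_ge1 n (v : 'cV[C]_n) :
  v \is a mxOver gint -> v != 0 -> 1 <= l2norm v.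
Proof.
move=> /mxOverP vg /eqP v0.
have [i vi0] : exists i, v i 0 != 0.
  apply/existsP; apply: contra_notT v0 => /existsPn v0.
  by apply/colP => i; rewrite mxE; apply/eqP; rewrite -[_ == _]negbK v0.
by apply: le_trans (l2norm_coord v i); apply: gint_norm_ge1.
Qed.

End GaussianIntegers.

(** * Independent vectors, isometries and Gram volumes of integral families *)

Section Frames.
Variable K : realType.
Local Notation C := K[i].
Local Notation nc := (@Normc.normc K).

Lemma dim_cV m : \dim {:'cV[C]_m} = m.
Proof. by rewrite dimvf dim_matrix; exact: muln1. Qed.

Lemma dim_orthcompl m (L : {vspace 'cV[C]_m}) :
  (\dim L + \dim (orthcompl L))%N = m.
Proof.
by rewrite -(dimv_disjoint_sum (orthcompl_cap L)) orthcompl_add dim_cV.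
Qed.

Lemma dim_le_m m (L : {vspace 'cV[C]_m}) : (\dim L <= m)%N.
Proof. by rewrite -[leqRHS](dim_orthcompl L) leq_addr. Qed.

Lemma leq_dim_cap m (S T : {vspace 'cV[C]_m}) :
  (\dim S + \dim T <= \dim (S :&: T) + m)%N.
Proof. by rewrite -dimv_sum_cap addnC leq_add2l dim_le_m. Qed.

(** Families are functions on [nat] of which only the first [k] values matter, so that prefixes can
    be taken without casts between ordinals. *)
Definition colsmx m k (z : nat -> 'cV[C]_m) : 'M[C]_(m, k) :=
  \matrix_(i, j) z j i 0.

Lemma colsmx_mul m k (z : nat -> 'cV[C]_m) (c : 'cV[C]_k) :
  colsmx k z *m c = \sum_(j < k) c j 0 *: z j.
Proof.
apply/colP => i; rewrite mxE summxE; apply: eq_bigr => j _.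
by rewrite !mxE mulrC.
Qed.

Lemma dim_span_mkseq m k (z : nat -> 'cV[C]_m) :
  (\dim <<mkseq z k>> <= k)%N.
Proof. by rewrite -[leqRHS](size_mkseq z) dim_span. Qed.

Lemma mem_span_colsmx m k (z : nat -> 'cV[C]_m) v :
  v \in <<mkseq z k>>%VS -> exists c, v = colsmx k z *m c.
Proof.
pose X : k.-tuple 'cV[C]_m := Tuple (introT eqP (size_mkseq z k)).
move/(coord_span (X := X)) => ->.
exists (\col_j coord X j v); rewrite colsmx_mul.
by apply: eq_bigr => j _; rewrite mxE /= nth_mkseq.
Qed.

Lemma colsmx_inj m k (z : nat -> 'cV[C]_m) (c : 'cV[C]_k) :
  free (mkseq z k) -> colsmx k z *m c = 0 -> c = 0.
Proof.
pose X : k.-tuple 'cV[C]_m := Tuple (introT eqP (size_mkseq z k)).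
move=> /(@freeP _ _ _ X) zfree; rewrite colsmx_mul => zc0.
apply/colP => j; rewrite mxE.
apply: (zfree (fun j => c j 0)); rewrite -[RHS]zc0.
by apply: eq_bigr => i _; rewrite /= nth_mkseq.
Qed.

Lemma mem_mkseq_lt (T : eqType) k (z : nat -> T) j : (j < k)%N ->
  z j \in mkseq z k.
Proof. by move=> jk; apply: map_f; rewrite mem_iota. Qed.

Lemma mem_mkseq_ltP (T : eqType) k (z : nat -> T) v :
  reflect (exists2 i, (i < k)%N & v = z i) (v \in mkseq z k).
Proof.
apply: (iffP mapP) => -[j]; rewrite ?mem_iota => jk ->.
  by exists j.
by exists j; rewrite ?mem_iota.
Qed.

Lemma free_mkseqS m k (z : nat -> 'cV[C]_m) :
  free (mkseq z k.+1) = (z k \notin <<mkseq z k>>%VS) && free (mkseq z k).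
Proof. by rewrite mkseqS (perm_free (Y :=
  z k :: mkseq z k)) ?perm_rcons ?free_cons. Qed.

Lemma eq_mkseq_lt (T : Type) (f g : nat -> T) k :
  (forall i, (i < k)%N -> f i = g i) -> mkseq f k = mkseq g k.
Proof.
move=> fg; case: k fg => // k fg.
apply: (@eq_from_nth _ (f 0)); rewrite ?size_mkseq // => i ik.
by rewrite !nth_mkseq // fg.
Qed.

(** Greedy choice: [S i] spans more than [i] dimensions, so one of its members lies outside the span
    of the [i] vectors chosen before. *)
Lemma free_transversal m k (S : nat -> seq 'cV[C]_m) :
    (forall i, (i < k)%N -> (i < \dim <<S i>>)%N) ->
  exists2 z, free (mkseq z k) & forall i, (i < k)%N -> z i \in S i.
Proof.
elim: k => [|k IHk] dimS; first by exists (fun _ => 0); rewrite ?nil_free.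
have [|z zfree zS] := IHk; first by move=> i ik; rewrite dimS // ltnW.
have /allPn[v vS vz] : ~~ all (fun v => v \in <<mkseq z k>>%VS) (S k).
  apply/negP => /allP Sz; have := dimS k (ltnSn k); rewrite ltnNge => /negP;
    apply.
  by apply: leq_trans (dim_span_mkseq k z); apply: dimvS; apply/span_subvP.
pose z' i := if i == k then v else z i.
have z'E : mkseq z' k = mkseq z k.
  by apply: eq_mkseq_lt => i ik; rewrite /z' ltn_eqF.
exists z' => [|i]; first by rewrite free_mkseqS z'E {1}/z' eqxx vz.
rewrite ltnS leq_eqVlt /z'; case: eqP => [->|_] //= ik; exact: zS.
Qed.

Lemma l2norm_normalize m (v : 'cV[C]_m) :
  v != 0 -> l2norm (((l2norm v)^-1)%:C%C *: v) = 1.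
Proof.
move=> v0; rewrite l2normZ nc_real ger0_norm ?invr_ge0 ?l2norm_ge0 //.
by rewrite mulVf // l2norm_eq0.
Qed.

(** Gram-Schmidt with prescribed spaces: a space of dimension above [k] meets the orthogonal
    complement of [k] vectors nontrivially. *)
Lemma orthonormal_flag m k (S : nat -> {vspace 'cV[C]_m}) :
    (forall i, (i < k)%N -> (i < \dim (S i))%N) ->
  exists w, (forall i, (i < k)%N -> w i \in S i) /\
    (forall i j, (i < k)%N -> (j < k)%N -> dotcv (w i) (w j) = (i == j)%:R).
Proof.
elim: k => [|k IHk] dimS; first by exists (fun _ => 0); split.
have [|w [wS ww]] := IHk; first by move=> i ik; rewrite dimS // ltnW.
pose O := orthcompl <<mkseq w k>>.
have : (0 < \dim (S k :&: O))%N.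
  rewrite -(ltn_add2r m); apply: leq_trans (leq_dim_cap _ _).
  rewrite -[X in (_ + X < _)%N](dim_orthcompl <<mkseq w k>>) -/O add0n
    ltn_add2r.
  by apply: leq_ltn_trans (dim_span_mkseq _ _) (dimS _ _).
rewrite lt0n dimv_eq0 => SO0.
have /memv_capP[uS /mem_orthovP uO] := memv_pick (S k :&: O)%VS.
move: SO0; rewrite -vpick0; set u := vpick _ in uS uO * => u0.
pose v := ((l2norm u)^-1)%:C%C *: u.
have vw i : (i < k)%N -> dotcv v (w i) = 0.
  move=> ik; rewrite linearZl_LR /= uO ?mulr0 //.
  by apply: memv_span; apply: mem_mkseq_lt.
have vv : dotcv v v = 1 by rewrite -l2norm_dot l2norm_normalize ?expr1n.
exists (fun i => if i == k then v else w i); split=> [i|i j].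
  rewrite ltnS leq_eqVlt; case: eqP => [->|_] /= ik; last exact: wS.
  by rewrite memvZ.
rewrite !ltnS (leq_eqVlt i) (leq_eqVlt j).
case: eqP => [->|/eqP ik] /=; case: eqP => [->|/eqP jk] //=;
  rewrite ?eqxx // => iltk jltk.
- by rewrite vw // eq_sym (negbTE jk).
- by rewrite dotcv_conj vw // rmorph0 (negbTE ik).
- exact: ww.
Qed.

Lemma colsmx_isometry m k (w : nat -> 'cV[C]_m) :
    (forall i j, (i < k)%N -> (j < k)%N -> dotcv (w i) (w j) = (i == j)%:R) ->
  (colsmx k w) ^t* *m colsmx k w = 1%:M.
Proof.
move=> ww; apply/matrixP => i j; rewrite !mxE -[RHS]/((i == j :> nat)%:R).
rewrite eq_sym -ww // dotcvE !mxE; apply: eq_bigr => l _.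
by rewrite !mxE.
Qed.

Lemma col_colsmx m k (z : nat ->
  'cV[C]_m) (j : 'I_k) : col j (colsmx k z) = z j.
Proof. by apply/colP => i; rewrite !mxE. Qed.

(** The [k] orthonormal columns lie in a space of dimension at most [k], so they form a basis of it,
    and [W] times its adjoint is the projection onto it. *)
Lemma isometry_span m k (W : 'M[C]_(m, k)) (z : nat -> 'cV[C]_m) :
    W ^t* *m W = 1%:M -> (forall j, col j W \in <<mkseq z k>>%VS) ->
  forall v, v \in <<mkseq z k>>%VS -> W *m (W ^t* *m v) = v.
Proof.
move=> WW Wz v vz.
have WE : W = colsmx k (fun i => if insub i is Some j then col j W else 0).
  by apply/matrixP => i j; rewrite mxE valK mxE.
set w := fun i => _ in WE.
have wz : (<<mkseq w k>> <= <<mkseq z k>>)%VS.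
  apply/span_subvP => u /mem_mkseq_ltP[i ik ->].
  by rewrite /w insubT Wz.
have wfree : free (mkseq w k).
  pose X : k.-tuple 'cV[C]_m := Tuple (introT eqP (size_mkseq w k)).
  apply/(@freeP _ _ _ X) => c wc0 j.
  have Wc0 : W *m (\col_j c j) = 0.
    by rewrite WE colsmx_mul -[RHS]wc0; apply: eq_bigr => l _;
      rewrite mxE nth_mkseq.
  have := congr1 (mulmx (W ^t*)) Wc0; rewrite mulmxA WW mul1mx mulmx0.
  by move/colP/(_ j); rewrite !mxE.
have wzE : <<mkseq w k>>%VS = <<mkseq z k>>%VS.
  apply/eqP; rewrite eqEdim wz; have := wfree;
    rewrite /free size_mkseq => /eqP ->.
  exact: dim_span_mkseq.
have [c ->] : exists c, v = W *m c by rewrite WE; apply: mem_span_colsmx;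
  rewrite wzE.
by rewrite [W ^t* *m _]mulmxA WW mul1mx.
Qed.

(** Leibniz expansion: each of the [k!] terms obeys the same bound, since a permutation only
    reorders the factors [b j]. *)
Lemma det_norm_le k (Z : 'M[C]_k) (a b : 'I_k -> K) :
    (forall i j, nc (Z i j) <= a i * b j) ->
  nc (\det Z) <= k`!%:R * \prod_i a i * \prod_j b j.
Proof.
move=> Zab; apply: le_trans (nc_sum _ _ _) _.
have -> : k`!%:R * \prod_i a i * \prod_j b j =
    \sum_(s : 'S_k) (\prod_i a i * \prod_j b j).
  rewrite sumr_const -mulrA mulr_natl; congr (_ *+ _).
  by rewrite -card_Sn; apply: eq_card.
apply: ler_sum => s _; rewrite Normc.normcM nc_prod.
rewrite [\prod_j b j](reindex_inj (@perm_inj _ s)) /= -big_split /=.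
have -> : nc ((-1) ^+ s) = 1.
  by case: (odd_perm s); rewrite ?expr1 ?expr0 ?normcN (Normc.normc1 K).
by rewrite mul1r; apply: ler_prod => i _; rewrite nc_ge0 Zab.
Qed.

Lemma prod_ord_ltn k q (a b : K) : (q <= k)%N ->
  \prod_(i < k) (if (i < q)%N then a else b) = a ^+ q * b ^+ (k - q).
Proof.
move=> qk; rewrite -(big_mkord xpredT (fun i => if (i < q)%N then a else b)).
rewrite (@big_cat_nat _ _ _ q) //=; congr (_ * _).
  by rewrite (eq_big_nat _ _ (F2 :=
    fun=> a)) ?prodr_const_nat ?subn0 // => i /andP[_ ->].
rewrite (eq_big_nat _ _ (F2 := fun=> b)) ?prodr_const_nat // => i /andP[qi _].
by rewrite ltnNge qi.
Qed.

Lemma dotcv_col m k l (Z : 'M[C]_(m, k)) (W : 'M[C]_(m, l)) i j :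
  dotcv (col j Z) (col i W) = (W ^t* *m Z) i j.
Proof. by rewrite dotcvE !mxE; apply: eq_bigr => h _; rewrite !mxE. Qed.

Lemma l2norm_col_isometry m k (W : 'M[C]_(m, k)) i :
  W ^t* *m W = 1%:M -> l2norm (col i W) = 1.
Proof.
move=> WW; apply/(@pexpIrn _ 2); rewrite ?nnegrE ?l2norm_ge0 ?ler01 // expr1n.
by apply: (@complexI K); rewrite l2norm_dot dotcv_col WW mxE eqxx.
Qed.

Lemma nc_det_adj n (W : 'M[C]_n) :
  W ^t* *m W = 1%:M -> nc (\det (W ^t*)) = 1.
Proof.
move=> /(congr1 (fun X => nc (\det X))).
rewrite det_mulmx det1 Normc.normcM (Normc.normc1 K) det_map_mx det_tr nc_conj.
by move=> /eqP; rewrite -expr2 sqrp_eq1 ?nc_ge0 // => /eqP.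
Qed.

Lemma mul_adj_entry m k (W : 'M[C]_(m, k)) v i :
  (W ^t* *m v) i 0 = dotcv v (col i W).
Proof. by rewrite dotcvE !mxE; apply: eq_bigr => l _; rewrite !mxE. Qed.

Lemma col_mulmx m k l (A : 'M[C]_(m, k)) (B : 'M[C]_(k, l)) j :
  A *m col j B = col j (A *m B).
Proof. by rewrite !colE mulmxA. Qed.

(* |det (W^* Z)|^2 is the Gram determinant of Z, a nonzero Gaussian integer. *)
Lemma gint_frame m k q (z : nat -> 'cV[C]_m) (S : {vspace 'cV[C]_m}) :
    (forall j, (j < k)%N -> z j \is a mxOver (gint K)) -> free (mkseq z k) ->
    (q + m <= \dim S + k)%N ->
  exists W : 'M[C]_(m, k),
    [/\ W ^t* *m W = 1%:M,
        forall j : 'I_k, (j < q)%N -> col j W \in S,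
        forall v, v \in <<mkseq z k>>%VS -> W *m (W ^t* *m v) = v
      & 1 <= nc (\det (W ^t* *m colsmx k z))].
Proof.
move=> zg zfree qS; set V := <<mkseq z k>>%VS.
have dimV : \dim V = k by move: zfree; rewrite /free size_mkseq => /eqP.
(* The space [S :&: V] has dimension at least [\dim S + k - m], so it has room for the first [q]
   orthonormal vectors. *)
pose T i := if (i < q)%N then (S :&: V)%VS else V.
have [i ik|w [wT ww]] := @orthonormal_flag m k T.
  rewrite /T; case: (ltnP i q) => iq; last by rewrite dimV.
  apply: leq_trans iq _; rewrite -(leq_add2r m); apply: leq_trans qS _.
  by rewrite -[X in (_ + X <= _)%N]dimV leq_dim_cap.
have wV i : (i < k)%N -> w i \in V.
  by move/wT; rewrite /T; case: ifP => // _; rewrite memv_cap => /andP[].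
set W := colsmx k w.
have WW : W ^t* *m W = 1%:M by apply: colsmx_isometry.
have WV v : v \in V -> W *m (W ^t* *m v) = v.
  by apply: isometry_span => // j; rewrite col_colsmx wV.
exists W; split=> // [j jq|].
  by rewrite col_colsmx; have := wT j (ltn_ord j);
    rewrite /T jq memv_cap => /andP[].
set Z := colsmx k z; set D := \det _.
have WZ : W *m (W ^t* *m Z) = Z.
  apply/matrixP => i j.
  have := WV (z j) (memv_span (mem_mkseq_lt z (ltn_ord j))).
  rewrite -col_colsmx -/Z !col_mulmx => /colP/(_ i).
  by rewrite [LHS]mxE [RHS]mxE.
have D0 : D != 0.
  rewrite /D -det_tr; apply/det0P => -[v v0 /(congr1 trmx)].
  rewrite trmx_mul trmxK trmx0 => WZv; case/eqP: v0; apply: trmx_inj;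
    rewrite trmx0.
  apply: (colsmx_inj zfree); rewrite -/Z -WZ -mulmxA WZv mulmx0 //.
have DE : \det (Z ^t* *m Z) = D^* * D.
  rewrite -{1}WZ trmx_mul map_mxM -mulmxA /= det_mulmx.
  by rewrite det_map_mx det_tr -/D.
have Dg : D^* * D \is a gint K.
  rewrite -DE; apply: gint_det; apply/mxOverP => i j; rewrite mxE.
  apply: rpred_sum => l _; rewrite !mxE rpredM ?gint_conj //.
    exact: (mxOverP (zg i (ltn_ord i))).
  exact: (mxOverP (zg j (ltn_ord j))).
have := gint_norm_ge1 Dg; rewrite mulf_neq0 ?conjC_eq0 // => /(_ isT).
rewrite Normc.normcM nc_conj -expr2 -[leLHS](expr1n _ 2).
by rewrite ler_pXn2r ?nnegrE ?nc_ge0.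
Qed.

(** The determinant from [gint_frame] has modulus at least 1. In its Leibniz bound, the [q] rows
    given by unit vectors of [S] contribute a factor [a] each, the other rows [b], and column [j]
    contributes [mu j]. *)
Lemma gint_volume m k q (z : nat -> 'cV[C]_m) (S : {vspace 'cV[C]_m})
    (a b : K) (mu : nat -> K) :
    (forall j, (j < k)%N -> z j \is a mxOver (gint K)) -> free (mkseq z k) ->
    (q <= k)%N -> (q + m <= \dim S + k)%N ->
    (forall j x, (j < k)%N -> x \in S ->
      nc (dotcv (z j) x) <= a * l2norm x * mu j) ->
    (forall j x, (j < k)%N -> nc (dotcv (z j) x) <= b * l2norm x * mu j) ->
  1 <= k`!%:R * (a ^+ q * b ^+ (k - q)) * \prod_(j < k) mu j.
Proof.
move=> zg zfree qk qS aS bS.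
have [W [WW WS _ /le_trans]] := gint_frame zg zfree qS; apply.
rewrite -(prod_ord_ltn a b qk); apply: det_norm_le => i j.
have nW := l2norm_col_isometry i WW.
rewrite -dotcv_col col_colsmx.
case: (ltnP i q) => iq.
  by have := aS j (col i W) (ltn_ord j) (WS i iq); rewrite nW mulr1.
by have := bS j (col i W) (ltn_ord j); rewrite nW mulr1.
Qed.

(** Cramer's rule in an orthonormal frame of the span: the determinant has modulus at least 1, and
    each of the [k] cofactors involved is at most [(k-1)! D^(k-1)]. *)
Lemma gint_coord m k (z : nat -> 'cV[C]_m) (D : K) v :
    (forall j, (j < k)%N -> z j \is a mxOver (gint K)) -> free (mkseq z k) ->
    (forall j, (j < k)%N -> l2norm (z j) <= D) -> v \in <<mkseq z k>>%VS ->
  exists2 c : nat -> C, v = \sum_(j < k) c j *: z j &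
    forall j, (j < k)%N -> nc (c j) <= k`!%:R * D ^+ k.-1 * l2norm v.
Proof.
move=> zg zfree zD vz.
(* With [q = 0] no column of the frame is constrained; only the volume bound matters. *)
have [|W [WW _ WV D1]] := @gint_frame m k 0 z fullv zg zfree.
  by rewrite dim_cV leq_addr.
have [c0 vE] := mem_span_colsmx vz.
pose c j := if insub j is Some i then c0 i 0 else 0.
have cE (j : 'I_k) : c j = c0 j 0 by rewrite /c valK.
exists c; first by rewrite vE colsmx_mul; apply: eq_bigr => j _; rewrite cE.
move=> j jk; have -> : c j = c0 (Ordinal jk) 0 by rewrite -cE.
set j' := Ordinal jk; set X := W ^t* *m colsmx k z in D1.
have XE : \det X *: c0 = \adj X *m (W ^t* *m v).
  by rewrite vE [W ^t* *m _]mulmxA mulmxA mul_adj_mx mul_scalar_mx.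
have nX i l : nc (X i l) <= 1 * D.
  rewrite -dotcv_col col_colsmx; apply: le_trans (l2norm_CS _ _) _.
  by rewrite (l2norm_col_isometry i WW) mulr1 mul1r zD.
have lW : l2norm (W ^t* *m v) = l2norm v.
  by rewrite -[in RHS](WV v vz) (l2norm_isometry _ WW).
apply: (@le_trans _ _ (nc (\det X) * nc (c0 j' 0))).
  by rewrite ler_peMl ?nc_ge0.
have -> : nc (\det X) * nc (c0 j' 0) = nc ((\det X *: c0) j' 0).
  by rewrite mxE Normc.normcM.
rewrite XE mxE; apply: le_trans (nc_sum _ _ _) _.
have -> : k`!%:R * D ^+ k.-1 * l2norm v =
    \sum_(i < k) (k.-1)`!%:R * D ^+ k.-1 * l2norm v.
  have kE : k`! = (k * (k.-1)`!)%N.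
    by rewrite -{1 2}(prednK (leq_ltn_trans (leq0n j) jk)) factS.
  by rewrite sumr_const card_ord -[RHS]mulr_natl !mulrA -natrM -kE.
apply: ler_sum => i _; rewrite Normc.normcM ler_pM ?nc_ge0 //; last first.
  by rewrite -lW l2norm_coord.
rewrite mxE /cofactor Normc.normcM.
have -> : nc ((-1) ^+ (i + j')) = 1.
  by rewrite -signr_odd; case: odd;
    rewrite ?expr1 ?expr0 ?normcN (Normc.normc1 K).
rewrite mul1r; apply: le_trans (@det_norm_le _ _ (fun=> 1) (fun=> D) _) _.
  by move=> h l; rewrite 2!mxE nX.
by rewrite !prodr_const card_ord expr1n mulr1.
Qed.

End Frames.

(** * Lattice reduction *)

Section Reduction.
Variable K : realType.
Local Notation C := K[i].
Local Notation nc := (@Normc.normc K).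

(** A Gaussian integer of modulus 1 is a unit, so the columns of [U] form a basis of the lattice of
    Gaussian-integer vectors. *)
Definition unimod n (U : 'M[C]_n) : Prop :=
  U \is a mxOver (gint K) /\ nc (\det U) = 1.

Lemma unimodM n (U V : 'M[C]_n) : unimod U -> unimod V -> unimod (U *m V).
Proof.
move=> [/mxOverP Ug U1] [/mxOverP Vg V1]; split; last first.
  by rewrite det_mulmx Normc.normcM U1 V1 mulr1.
by apply/mxOverP => i j; rewrite mxE rpred_sum // => l _; rewrite rpredM.
Qed.

Lemma unimod1 n : unimod (1%:M : 'M[C]_n).
Proof.
split; last by rewrite det1 (Normc.normc1 K).
by apply: mxOver_scalar; rewrite ?rpred0 ?rpred1.
Qed.

Lemma unimod_unit n (U : 'M[C]_n) : unimod U -> U \in unitmx.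
Proof. by case=> _ U1; rewrite unitmxE unitfE -nc_eq0 U1 oner_eq0. Qed.

Lemma unimod_perm n (s : 'S_n) : unimod (perm_mx s : 'M[C]_n).
Proof.
split; first by apply/mxOverP => i j; rewrite !mxE; case: eqP;
  rewrite ?rpred0 ?rpred1.
rewrite det_perm.
by case: (odd_perm s); rewrite ?expr1 ?expr0 ?normcN (Normc.normc1 K).
Qed.

Lemma unimod_col_gint n (U : 'M[C]_n) j : unimod U ->
  col j U \is a mxOver (gint K).
Proof. by case=> /mxOverP Ug _; apply/mxOverP => i k; rewrite mxE. Qed.

Lemma unimod_col_neq0 n (U : 'M[C]_n) j : unimod U -> col j U != 0.
Proof.
move=> /unimod_unit Uu; apply/eqP => /(congr1 (mulmx (invmx U))).
rewrite col_mulmx mulVmx // mulmx0 => /colP/(_ j); rewrite !mxE eqxx => /eqP.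
by rewrite oner_eq0.
Qed.

Lemma unimod_block n (s : 'rV[C]_n) (U : 'M[C]_n) :
  s \is a mxOver (gint K) -> unimod U ->
  unimod (block_mx 1%:M s 0 U : 'M_(1 + n)).
Proof.
move=> /mxOverP sg [/mxOverP Ug U1]; split; last first.
  by rewrite det_ublock det1 mul1r U1.
apply/mxOverP => i j.
rewrite -(fintype.splitK i) -(fintype.splitK j).
case: (fintype.split i) => i'; case: (fintype.split j) => j' /=.
- by rewrite block_mxEul mxE; case: eqP; rewrite ?rpred0 ?rpred1.
- by rewrite block_mxEur.
- by rewrite block_mxEdl mxE rpred0.
- by rewrite block_mxEdr.
Qed.

Lemma l2norm_mulmx_le m n (A : 'M[C]_(m, n)) :
  exists2 c, 0 < c & forall v, l2norm (A *m v) <= c * l2norm v.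
Proof.
exists (1 + \sum_j l2norm (col j A)) => [|v].
  by rewrite ltr_pwDl ?ltr01 // sumr_ge0 // => j _; exact: l2norm_ge0.
have -> : A *m v = \sum_j v j 0 *: col j A.
  apply/colP => i; rewrite mxE summxE; apply: eq_bigr => j _.
  by rewrite !mxE mulrC.
apply: le_trans (l2norm_sum _ _ _) _; rewrite mulrDl mul1r mulr_suml.
apply: ler_wpDl; first exact: l2norm_ge0.
apply: ler_sum => j _; rewrite l2normZ mulrC.
by apply: ler_wpM2l; rewrite ?l2norm_ge0 ?l2norm_coord.
Qed.

(** Only columns of unimodular matrices compete, so the winner comes with a basis containing it. The
    infimum of the lengths is positive because nonzero integral vectors have norm at least 1 and [g]
    is invertible; the slack [11 / 10] spares a proof that it is attained. *)
Lemma near_minimal_column n (g : 'M[C]_n.+1) : g \in unitmx ->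
  exists2 U, unimod U & forall U' j, unimod U' ->
    l2norm (g *m col ord0 U) <= 11 / 10 * l2norm (g *m col j U').
Proof.
move=> gu.
pose S : set K := [set x | exists U j,
  unimod U /\ x = l2norm (g *m col j U)]%classic.
have [c c0 cP] := l2norm_mulmx_le (invmx g).
have Slb : lbound S c^-1.
  move=> _ [U [j [Uu ->]]]; rewrite -[leLHS]mulr1 ler_pdivrMl //.
  apply: le_trans (cP _); rewrite mulKmx //.
  by apply: l2norm_gint_ge1; [exact: unimod_col_gint|exact: unimod_col_neq0].
have S0 : (S !=set0)%classic by exists (l2norm (g *m col ord0 1%:M)), 1%:M,
  ord0; split => //; exact: unimod1.
have Sinf : has_inf S by split=> //; exists c^-1.
have inf0 : 0 < inf S by apply: lt_le_trans (lb_le_inf S0 Slb);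
  rewrite invr_gt0.
have [|x [U [j [Uu xE]]] xlt] := @inf_adherent _ S (inf S / 10) _ Sinf.
  by rewrite divr_gt0.
(* A transposition moves the near-minimal column to the front. *)
exists (U *m perm_mx (tperm ord0 j)) => [|U' j' U'u].
  by apply: unimodM => //; exact: unimod_perm.
have -> : col ord0 (U *m perm_mx (tperm ord0 j)) = col j U.
  by apply/colP => i; rewrite -tpermV -col_permE !mxE tpermL.
rewrite -xE; apply: (@le_trans _ _ (11 / 10 * inf S)); first by lra.
rewrite ler_pM2l; last by lra.
have inf_le := ge_inf (proj2 Sinf).
by apply: inf_le; exists U', j'; split.
Qed.

(** [P] is the adjoint of an orthonormal basis whose first vector spans the line of [x]. *)
Lemma unitary_to_axis n (x : 'cV[C]_n.+1) :
  exists P : 'M[C]_n.+1, [/\ P ^t* *m P = 1%:M, nc (\det P) = 1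
    & forall i, i != ord0 -> (P *m x) i 0 = 0].
Proof.
have [->|x0] := eqVneq x 0.
  exists 1%:M; rewrite trmx1 map_mx1 mulmx1 det1 (Normc.normc1 K);
    split => // i _.
  by rewrite mulmx0 mxE.
pose S i := if i == 0%N then <[x]>%VS else fullv : {vspace 'cV[C]_n.+1}.
have [i|w [wS ww]] := @orthonormal_flag K n.+1 n.+1 S.
  by rewrite /S; case: eqP => [->|_] in_;
    rewrite ?dim_vector1 ?dim_cV ?dim_vline ?x0.
set W := colsmx n.+1 w; have WW : W ^t* *m W = 1%:M by exact: colsmx_isometry.
exists (W ^t*); rewrite trmxCK; split=> [||i i0].
- exact: mulmx1C.
- exact: nc_det_adj.
have : w 0%N \in S 0%N by exact: wS.
rewrite /S eqxx => /vlineP[a wa].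
have a0 : a != 0.
  apply/eqP => a0; have := ww 0%N 0%N isT isT.
  by rewrite wa a0 scale0r eqxx linear0l => /eqP; rewrite eq_sym oner_eq0.
have -> : x = a^-1 *: w 0%N by rewrite wa scalerA mulVf // scale1r.
rewrite -scalemxAr mxE.
have /negbTE i0' : (0 != i :> nat)%N by rewrite eq_sym.
by rewrite mul_adj_entry col_colsmx ww // i0' mulr0.
Qed.

Lemma gint_size_reduce n (a : C) (w : 'rV[C]_n) : a != 0 ->
  exists2 s : 'rV[C]_n, s \is a mxOver (gint K) &
    forall j, nc ((a *: s + w) 0 j) ^+ 2 <= nc a ^+ 2 / 2.
Proof.
move=> a0.
have ex_s (j : 'I_n) : exists s,
  s \is a gint K /\ nc (a^-1 * w 0 j + s) ^+ 2 <= 1 / 2.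
  by have [s] := gint_round (a^-1 * w 0 j); exists s.
have [s sP] := choice ex_s.
exists (\row_j s j) => [|j]; first by apply/mxOverP => i j; rewrite mxE;
  case: (sP j).
have [_] := sP j => sj; rewrite !mxE.
have -> : a * s j + w 0 j = a * (a^-1 * w 0 j + s j) by rewrite mulrDr mulVKf
  // addrC.
by rewrite Normc.normcM exprMn ler_pM2l ?exprn_gt0 ?lt0r ?nc_ge0 ?nc_eq0 ?a0
  //; lra.
Qed.

Lemma l2norm_col_mx n (a : 'cV[C]_1) (v : 'cV[C]_n) :
  l2norm (col_mx a v : 'cV_(1 + n)) ^+ 2 = nc (a 0 0) ^+ 2 + l2norm v ^+ 2.
Proof.
rewrite !l2norm_sqr big_split_ord /= big_ord1 col_mxEu; congr (_ + _).
by apply: eq_bigr => i _; rewrite col_mxEd.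
Qed.

(** With a factor [f] in place of [11 / 10], the hypotheses give [(1 - f^2/2) b^2 <= f^2 m^2], which
    suffices as soon as [f^2 <= 4/3]. *)
Lemma near_minimal_arith (b y m : K) : 0 <= b -> 0 <= y -> 0 <= m ->
  y ^+ 2 <= b ^+ 2 / 2 + m ^+ 2 -> b <= 11 / 10 * y -> b <= 2 * m.
Proof.
move=> b0 y0 m0 yle bly.
have : b ^+ 2 <= (11 / 10 * y) ^+ 2 by rewrite lerXn2r ?nnegrE //; lra.
have m2_ge0 : 0 <= 2 * m by lra.
by move=> {}bly; rewrite -(@ler_pXn2r _ 2) ?nnegrE //; nra.
Qed.

(** Indeed [y^2 <= 2 m^2 + m^2]. *)
Lemma size_reduced_arith (b y m : K) : 0 <= b -> 0 <= m ->
  y ^+ 2 <= b ^+ 2 / 2 + m ^+ 2 -> b <= 2 * m -> y <= 2 * m.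
Proof. by move=> b0 m0 yle b2m; nra. Qed.

(* Hermite reduction: the first basis vector is nearly shortest, the remaining
   ones come from the projected lattice and are size-reduced. *)
Lemma lattice_reduction n (g : 'M[C]_n) : g \in unitmx ->
  exists U (mu : nat -> K),
    [/\ unimod U,
        forall i j, (i <= j < n)%N -> mu i <= mu j,
        forall j : 'I_n, l2norm (g *m col j U) <= mu j
      & \prod_(j < n) mu j <= 2 ^+ 'C(n, 2) * nc (\det g)].
Proof.
elim: n g => [|n IHn] g gu.
  exists 1%:M, (fun _ => 0); split=> [|i j /andP[]||] //; first exact: unimod1.
    by case.
  by rewrite big_ord0 det_mx00 bin_small // expr0 (Normc.normc1 K) mulr1.
have [U Uu Umin] := near_minimal_column gu.
pose x := g *m col ord0 U; have [P [PP P1 Px]] := unitary_to_axis x.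
pose G : 'M[C]_(1 + n) := P *m g *m U.
have Gx i : G i 0 = (P *m x) i 0 by rewrite /x !col_mulmx mulmxA [RHS]mxE.
set a := G 0 0; set w : 'rV_n := ursubmx G; set g' : 'M_n := drsubmx G.
(* The rotation sends the first basis vector to the first axis, so [g'] describes the lattice
   projected orthogonally to that vector. *)
have GE : G = block_mx a%:M w 0 g'.
  rewrite -[LHS]submxK; congr block_mx; apply/matrixP => i j; rewrite !ord1.
    by rewrite [LHS]mxE [LHS]mxE [RHS]mxE mulr1n /a; congr (G _ _);
      apply/val_inj.
  by rewrite [LHS]mxE [LHS]mxE [RHS]mxE -[RHS](Px (rshift 1 i)) // -Gx;
    congr (G _ _); apply/val_inj.
have detG : nc (\det G) = nc (\det g).
  by rewrite !det_mulmx !Normc.normcM P1 mul1r (proj2 Uu) mulr1.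
have detG' : nc (\det G) = nc a * nc (\det g').
  by rewrite GE det_ublock det_scalar1 Normc.normcM.
have g0 : \det g != 0 by rewrite -unitfE -unitmxE.
have /andP[a0 g'0] : (a != 0) && (\det g' != 0).
  by rewrite -negb_or -!nc_eq0 -mulf_eq0 -detG' detG nc_eq0.
have [|U' [mu' [U'u mu'mono mu'P mu'prod]]] := IHn g'.
  by rewrite unitmxE unitfE.
have [s sg sP] := gint_size_reduce (w *m U') a0.
pose U1 : 'M[C]_(1 + n) := U *m block_mx 1%:M s 0 U'.
have U1u : unimod U1 by apply: unimodM => //; exact: unimod_block.
have GU1 : P *m g *m U1 = block_mx a%:M (a *: s + w *m U') 0 (g' *m U').
  transitivity (@mulmx _ (1 + n) (1 + n) (1 + n) G (block_mx 1%:M s 0 U')).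
    by rewrite /U1 mulmxA.
  rewrite {1}GE mulmx_block !mulmx1 !mulmx0 !mul0mx !addr0 !add0r.
  by rewrite mul_scalar_mx.
have normU1 j : l2norm (g *m col j U1) =
    l2norm (@col _ (1 + n) (1 + n) j (block_mx a%:M (a *: s + w *m U') 0 (g' *m
      U'))).
  by rewrite -GU1 -[P *m g *m U1]mulmxA -!col_mulmx (l2norm_isometry _ PP).
have normU1_0 : l2norm (g *m col (lshift n 0) U1) = nc a.
  apply/(@pexpIrn _ 2); rewrite ?nnegrE ?l2norm_ge0 ?nc_ge0 //.
  rewrite normU1 block_mxEh colKl col_col_mx l2norm_col_mx.
  by rewrite !mxE mulr1n (_ : col 0 0 = 0) ?l2norm0 ?expr0n ?addr0 //;
    apply/colP => i; rewrite !mxE.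
have normU1_S j : l2norm (g *m col (rshift 1 j) U1) ^+ 2 <= nc a ^+ 2 / 2 + mu'
  j ^+ 2.
  rewrite normU1 block_mxEh colKr col_col_mx l2norm_col_mx mxE lerD ?sP //.
  by rewrite lerXn2r ?nnegrE ?l2norm_ge0 // -?col_mulmx // (le_trans
    (l2norm_ge0 _) (mu'P j)).
have a_eq : l2norm (g *m col ord0 U) = nc a.
  apply/(@pexpIrn _ 2); rewrite ?nnegrE ?l2norm_ge0 ?nc_ge0 //.
  rewrite -/x -(l2norm_isometry x PP) l2norm_sqr big_ord_recl big1 ?addr0 =>
    [|i _].
    by rewrite -Gx.
  by rewrite Px // (Normc.normc0 K) expr0n.
(* The near-minimal vector competes with the lifted vectors, which are columns of the unimodular
   [U1]. *)
have a_le (j : 'I_n) : nc a <= 2 * mu' j.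
  have := Umin U1 (rshift 1 j) U1u; rewrite a_eq => a_le.
  apply: near_minimal_arith (normU1_S j) a_le; rewrite ?nc_ge0 ?l2norm_ge0 //.
  exact: le_trans (l2norm_ge0 _) (mu'P j).
(* Doubling the bounds of the projected lattice makes the sequence monotone and absorbs the
   size-reduction error. The product gains [2 ^+ n], which matches ['C(n.+1, 2) = 'C(n, 2) + n]. *)
exists U1, (fun j => if j is j'.+1 then 2 * mu' j' else nc a).
split=> // [[|i] [|j]||] //=.
- rewrite ltnS => jn; exact: (a_le (Ordinal jn)).
- by rewrite !ltnS => ij; rewrite ler_pM2l ?ltr0n ?mu'mono.
- move=> j; case: (unliftP ord0 j) => [j'|] ->.
    rewrite lift0 /= (_ : lift ord0 j' = rshift 1 j'); last exact/val_inj.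
    apply: size_reduced_arith (normU1_S j') (a_le j'); rewrite ?nc_ge0 //.
    exact: le_trans (l2norm_ge0 _) (mu'P j').
  rewrite /= -normU1_0 le_eqVlt (_ : col _ U1 = col (lshift n 0) U1) ?eqxx //.
  by congr (col _ _); apply/val_inj.
rewrite big_ord_recl /= binS bin1 exprD big_split /= prodr_const card_ord.
rewrite -detG detG'.
have -> : 2 ^+ 'C(n, 2) * 2 ^+ n * (nc a * nc (\det g')) =
  nc a * (2 ^+ n * (2 ^+ 'C(n, 2) * nc (\det g'))) by ring.
by rewrite ler_wpM2l ?nc_ge0 // ler_wpM2l // exprn_ge0.
Qed.

End Reduction.

(** * Orthogonal projections *)

Section Projections.
Variable K : realType.
Local Notation C := K[i].
Local Notation nc := (@Normc.normc K).

Section OneSpace.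
Variables (m : nat) (L : {vspace 'cV[C]_m}).
Local Notation P := (orthproj L).
Implicit Types u v w : 'cV[C]_m.

Lemma orthproj_mem v : P v \in L.
Proof. by have [] := orthprojP L v. Qed.

Lemma orthproj_perp v u : u \in L -> dotcv (v - P v) u = 0.
Proof. by have [_] := orthprojP L v; apply. Qed.

Lemma l2norm_orthproj_min v w : w \in L -> l2norm (v - P v) <= l2norm (v - w).
Proof.
move=> wL; rewrite -(@ler_pXn2r _ 2) ?nnegrE ?l2norm_ge0 //.
have -> : v - w = (v - P v) + (P v - w) by rewrite addrA subrK.
rewrite [leRHS]l2normD_orth ?lerDl ?sqr_ge0 //.
by rewrite orthproj_perp // memvB ?orthproj_mem.
Qed.

Lemma orthproj_pythagoras v :
  l2norm v ^+ 2 = l2norm (P v) ^+ 2 + l2norm (v - P v) ^+ 2.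
Proof.
rewrite -{1}(subrK (P v) v) [LHS]l2normD_orth; first exact: addrC.
by rewrite orthproj_perp ?orthproj_mem.
Qed.

Lemma l2norm_orthproj v : l2norm (P v) <= l2norm v.
Proof.
rewrite -(@ler_pXn2r _ 2) ?nnegrE ?l2norm_ge0 // [leRHS]orthproj_pythagoras.
by rewrite lerDl sqr_ge0.
Qed.

Lemma l2norm_orthproj_sub v : l2norm (v - P v) <= l2norm v.
Proof.
rewrite -(@ler_pXn2r _ 2) ?nnegrE ?l2norm_ge0 // [leRHS]orthproj_pythagoras.
by rewrite lerDr sqr_ge0.
Qed.

Lemma orthproj_uniq v w :
  w \in L -> (forall u, u \in L -> dotcv (v - w) u = 0) -> P v = w.
Proof.
move=> wL vw; apply/eqP; rewrite -subr_eq0 -l2norm_eq0 -sqrf_eq0.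
have PwL : P v - w \in L by rewrite memvB ?orthproj_mem.
rewrite -(inj_eq (@complexI K)) l2norm_dot.
have {1}-> : P v - w = (v - w) - (v - P v) by rewrite opprB [RHS]addrC addrA
  subrK.
by rewrite dotcvBl vw // orthproj_perp // subrr.
Qed.

Lemma l2norm_orthproj_sqr v :
  (l2norm (P v) ^+ 2)%:C%C = dotcv v (P v).
Proof.
rewrite l2norm_dot -[X in dotcv X _ = _](subKr v) dotcvBl.
by rewrite orthproj_perp ?orthproj_mem // subr0.
Qed.

End OneSpace.

Lemma mem_orthcompl m (L : {vspace 'cV[C]_m}) v :
  reflect (forall u, u \in L -> dotcv v u = 0) (v \in orthcompl L).
Proof. exact: mem_orthovP. Qed.

Lemma orthproj_orthcompl m (L : {vspace 'cV[C]_m}) v :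
  orthproj (orthcompl L) v = v - orthproj L v.
Proof.
apply: orthproj_uniq => [|u /mem_orthcompl uL].
  by apply/mem_orthcompl => u; exact: orthproj_perp.
by rewrite subKr dotcv_conj uL ?orthproj_mem // conjC0.
Qed.

Lemma orthproj_orthcompl_sub m (L : {vspace 'cV[C]_m}) v :
  v - orthproj (orthcompl L) v = orthproj L v.
Proof. exact: etrans (congr1 (+%R v \o -%R) (orthproj_orthcompl L v)) (subKr _
  _). Qed.

(** Transfers estimates to orthogonal complements: the integral basis available on the side of [Ls]
    spans [orthcompl Ls]. *)
Lemma orthprojB_orthcompl m (L L' : {vspace 'cV[C]_m}) v :
  orthproj L v - orthproj L' v =
    - (orthproj (orthcompl L) v - orthproj (orthcompl L') v).
Proof.
have eqP := orthproj_orthcompl_sub L v;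
  have eqP' := orthproj_orthcompl_sub L' v.
have arith (V : zmodType) (x a b : V) : (x - a) - (x - b) = - (a - b).
  by rewrite opprB addrC addrA subrK opprB.
exact: etrans (esym (congr2 (fun a b => a - b) eqP eqP')) (arith _ _ _ _).
Qed.

Lemma opnorm_le m n (f : 'Hom('cV[C]_n, 'cV[C]_m)) d :
  (forall v, l2norm (f v) <= d * l2norm v) -> 0 <= d -> opnorm f <= d.
Proof.
move=> fd d0; apply: ge_sup; first by case: (opnorm_has_sup f).
move=> _ [v /= v1 <-]; apply: le_trans (fd v) _.
by rewrite -[leRHS]mulr1 ler_wpM2l.
Qed.

(* ||P - Q|| <= ||P (1 - Q)|| + ||(1 - P) Q||, and for equal dimensions the
   hypothesis on (1 - P) Q also controls (1 - Q) P, the adjoint of P (1 - Q). *)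
Lemma orthproj_close m (Y R : {vspace 'cV[C]_m}) d :
    \dim Y = \dim R -> 0 <= d -> d <= 1 / 2 ->
    (forall v, v \in Y -> l2norm (v - orthproj R v) <= d * l2norm v) ->
  forall x, l2norm (orthproj R x - orthproj Y x) <= 3 * d * l2norm x.
Proof.
move=> dimYR d0 d12 Yd.
(* Since [d <= 1 / 2], projecting to [R] at most halves the norm on [Y]; hence it is injective there
   and, by equality of dimensions, onto [R]. *)
have Y2 v : v \in Y -> l2norm v <= 2 * l2norm (orthproj R v).
  move=> vY; have := Yd v vY.
  have := l2normD (v - orthproj R v) (orthproj R v); rewrite subrK.
  have := l2norm_ge0 v; nra.
have imY : (orthproj R @: Y)%VS = R.
  apply/eqP; rewrite eqEdim; apply/andP; split.
    by apply/subvP => _ /memv_imgP[v _ ->]; exact: orthproj_mem.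
  rewrite -dimYR -(limg_ker_dim (orthproj R) Y) -[leqRHS]add0n leq_add2r leqn0
    dimv_eq0.
  apply/eqP/eqP; rewrite -subv0; apply/subvP => v;
    rewrite memv_cap memv_ker memv0.
  case/andP => vY /eqP Rv0; have := Y2 v vY; rewrite Rv0 l2norm0 mulr0 => v0.
  by rewrite -l2norm_eq0 eq_le v0 l2norm_ge0.
(* Lifting [w] to some [v] in [Y] bounds the distance of [w] to [Y] by that between [v] and [w], and
   [v] is at most twice as long as [w]. *)
have R2 w : w \in R -> l2norm (w - orthproj Y w) <= 2 * d * l2norm w.
  rewrite -{1}imY => /memv_imgP[v vY ->].
  apply: le_trans (l2norm_orthproj_min _ vY) _.
  rewrite -l2normN opprB; apply: le_trans (Yd v vY) _.
  by rewrite -mulrA mulrCA; apply: ler_wpM2l => //; exact: Y2.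
(* The squared norm of [orthproj R u] is its pairing with [u], which only sees the component
   orthogonal to [Y]; that component is small by [R2]. *)
have perp u : (forall y, y \in Y -> dotcv u y = 0) ->
    l2norm (orthproj R u) <= 2 * d * l2norm u.
  move=> uY; have [/eqP|Ru0] := eqVneq (l2norm (orthproj R u)) 0.
    by move/eqP => ->; rewrite mulr_ge0 ?mulr_ge0 ?l2norm_ge0.
  have Rp : 0 < l2norm (orthproj R u) by rewrite lt0r Ru0 l2norm_ge0.
  rewrite -(ler_pM2l Rp) -expr2.
  have -> : l2norm (orthproj R u) ^+ 2 =
      nc (dotcv u (orthproj R u - orthproj Y (orthproj R u))).
    rewrite dotcvBr (uY _ (orthproj_mem Y _)) subr0.
    by rewrite -l2norm_orthproj_sqr nc_real ger0_norm ?sqr_ge0.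
  apply: le_trans (l2norm_CS _ _) _; rewrite mulrC mulrA.
  apply: ler_wpM2r; first exact: l2norm_ge0.
  by rewrite mulrC R2 ?orthproj_mem.
move=> x; pose y := orthproj Y x.
have -> : orthproj R x - y = orthproj R (x - y) - (y - orthproj R y).
  by rewrite linearB /= opprB addrA subrK.
apply: le_trans (l2normD _ _) _; rewrite l2normN.
have h1 : l2norm (orthproj R (x - y)) <= 2 * d * l2norm (x - y).
  by apply: perp => u; exact: orthproj_perp.
have h2 := Yd y (orthproj_mem Y x).
have h3 := l2norm_orthproj_sub Y x; have h4 := l2norm_orthproj Y x.
rewrite -/y in h3 h4; nra.
Qed.

Lemma l2norm_le_coord m (v w : 'cV[C]_m) a : 0 <= a ->
  (forall i, nc (v i 0) <= a * nc (w i 0)) -> l2norm v <= a * l2norm w.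
Proof.
move=> a0 vw; rewrite -(@ler_pXn2r _ 2) ?nnegrE ?mulr_ge0 ?l2norm_ge0 //.
rewrite exprMn !l2norm_sqr mulr_sumr; apply: ler_sum => i _.
by rewrite -exprMn lerXn2r ?nnegrE ?mulr_ge0 ?nc_ge0.
Qed.

Lemma orthonormal_split n (R : {vspace 'cV[C]_n}) :
  exists W : 'M[C]_n, [/\ W ^t* *m W = 1%:M,
    forall i : 'I_n, (i < \dim R)%N -> col i W \in R
  & forall i : 'I_n, (\dim R <= i)%N -> col i W \in orthcompl R].
Proof.
have [//|w [wR ww]] := @orthonormal_flag K n (\dim R) (fun=> R).
have [//|w' [wR' ww']] := @orthonormal_flag K n (\dim (orthcompl R)) (fun=>
  orthcompl R).
pose z i := if (i < \dim R)%N then w i else w' (i - \dim R)%N.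
have lt_sub i : (i < n)%N -> ~~ (i < \dim R)%N ->
  (i - \dim R < \dim (orthcompl R))%N.
  by move=> iltn; rewrite -leqNgt => Ri; rewrite ltn_subLR ?dim_orthcompl.
exists (colsmx n z); split=> [|i iR|i Ri].
- apply: colsmx_isometry => i j iltn jltn; rewrite /z.
  case: ifP => iR; case: ifP => jR; first exact: ww.
  + rewrite dotcv_conj (mem_orthcompl _ _ (wR' _ _)) ?wR ?lt_sub ?jR // conjC0.
    by case: eqP iR jR => // ->->.
  + rewrite (mem_orthcompl _ _ (wR' _ _)) ?wR ?lt_sub ?iR //.
    by case: eqP iR jR => // -> ->.
  rewrite ww' ?lt_sub ?iR ?jR //; congr (nat_of_bool _)%:R.
  by rewrite eqn_sub2rE // leqNgt ?iR ?jR.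
- by rewrite col_colsmx /z iR wR.
by rewrite col_colsmx /z ltnNge Ri wR' // lt_sub // -leqNgt.
Qed.

(** This is the stretching: in orthonormal coordinates adapted to [R], those along [R] are kept and
    the others are multiplied by [eps^-1]. *)
Lemma adapted_form n (R : {vspace 'cV[C]_n}) (eps : K) : 0 < eps -> eps <= 1 ->
  exists g : 'M[C]_n, [/\ g \in unitmx,
    nc (\det g) = eps^-1 ^+ (n - \dim R),
    forall v, l2norm v <= l2norm (g *m v),
    forall v, l2norm (orthproj R v) <= l2norm (g *m v)
  & forall v, l2norm (v - orthproj R v) <= eps * l2norm (g *m v)].
Proof.
move=> e0 e1; have [W [WW WR WR']] := orthonormal_split R.
pose d (i : 'I_n) : K := if (i < \dim R)%N then 1 else eps^-1.
have d0 i : 0 < d i by rewrite /d; case: ifP; rewrite ?ltr01 ?invr_gt0.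
have dge1 i : 1 <= d i by rewrite /d; case: ifP => // _; rewrite invf_ge1.
pose g := diag_mx (\row_i (d i)%:C%C) *m W ^t*.
have gE v i : nc ((g *m v) i 0) = d i * nc ((W ^t* *m v) i 0).
  by rewrite -mulmxA mul_diag_mx !mxE Normc.normcM nc_real ger0_norm // ltW.
have detg : nc (\det g) = eps^-1 ^+ (n - \dim R).
  rewrite det_mulmx det_diag Normc.normcM.
  rewrite (nc_det_adj WW) mulr1 nc_prod -[RHS]mul1r -[X in X * _](expr1n _
    (\dim R)).
  rewrite -prod_ord_ltn ?dim_le_m //; apply: eq_bigr => i _.
  by rewrite mxE nc_real ger0_norm // ltW.
have W'W : W ^t* ^t* *m W ^t* = 1%:M by rewrite trmxCK; exact: mulmx1C.
exists g; split=> // [|v|v|v].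
- by rewrite unitmxE unitfE -nc_eq0 detg expf_neq0 // invr_neq0 // gt_eqF.
- rewrite -(l2norm_isometry v W'W) -[leRHS]mul1r;
  apply: l2norm_le_coord => // i.
  by rewrite mul1r gE ler_peMl ?nc_ge0.
- rewrite -(l2norm_isometry _ W'W) -[leRHS]mul1r;
  apply: l2norm_le_coord => // i.
  rewrite mul1r gE !mul_adj_entry; case: (ltnP i (\dim R)) => iR.
    have -> : dotcv (orthproj R v) (col i W) = dotcv v (col i W).
      apply/esym/eqP; rewrite -subr_eq0 -dotcvBl.
      by rewrite orthproj_perp ?eqxx // WR.
    by rewrite ler_peMl ?nc_ge0.
  rewrite dotcv_conj (mem_orthcompl _ _ (WR' i iR)) ?orthproj_mem // conjC0.
  by rewrite (Normc.normc0 K) mulr_ge0 ?nc_ge0 // ltW.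
rewrite -(l2norm_isometry _ W'W); apply: l2norm_le_coord => [|i];
  first exact: ltW.
rewrite gE !mul_adj_entry; case: (ltnP i (\dim R)) => iR.
  by rewrite orthproj_perp ?WR // (Normc.normc0 K) !mulr_ge0 ?nc_ge0 // ltW.
have -> : d i = eps^-1 by rewrite /d ltnNge iR.
rewrite mulVKf; last by rewrite gt_eqF.
rewrite dotcvBl [X in _ - X]dotcv_conj.
by rewrite (mem_orthcompl _ _ (WR' i iR) _ (orthproj_mem R v)) conjC0 subr0.
Qed.

(** Reduction of the stretched lattice. Short stretched length forces a vector close to [R], and
    [1 <= mu j] because stretching does not shorten a nonzero integral vector. *)
Lemma approx_basis n (R : {vspace 'cV[C]_n}) (eps : K) : 0 < eps -> eps <= 1 ->
  exists (y : nat -> 'cV[C]_n) (mu : nat -> K),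
    [/\ free (mkseq y n) /\ forall j, (j < n)%N -> y j \is a mxOver (gint K),
        forall i j, (i <= j < n)%N -> mu i <= mu j,
        forall j, (j < n)%N -> 1 <= mu j,
        forall j, (j < n)%N -> [/\ l2norm (y j) <= mu j,
          l2norm (orthproj R (y j)) <= mu j
        & l2norm (y j - orthproj R (y j)) <= eps * mu j]
      & \prod_(j < n) mu j <= 2 ^+ 'C(n, 2) * eps^-1 ^+ (n - \dim R)].
Proof.
move=> e0 e1; have [g [gu detg g1 g2 g3]] := adapted_form R e0 e1.
have [U [mu [Uu mu_mono muP mu_prod]]] := lattice_reduction gu.
pose y j := if insub j is Some i then col i U else 0.
have yE j (jn : (j < n)%N) : y j = col (Ordinal jn) U.
  by rewrite /y insubT.
have UE : U = colsmx n y by apply/matrixP => i j; rewrite mxE /y valK mxE.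
exists y, mu; split=> //.
- split=> [|j jn]; last by rewrite yE; exact: unimod_col_gint.
  pose X : n.-tuple 'cV[C]_n := Tuple (introT eqP (size_mkseq y n)).
  apply/(@freeP _ _ _ X) => c yc0 j.
  have Uc0 : U *m (\col_j c j) = 0.
    by rewrite UE colsmx_mul -[RHS]yc0; apply: eq_bigr => l _;
      rewrite mxE nth_mkseq.
  have := congr1 (mulmx (invmx U)) Uc0; rewrite mulKmx ?unimod_unit // mulmx0.
  by move/colP/(_ j); rewrite !mxE.
- move=> j jn; apply: le_trans (muP (Ordinal jn)); apply: le_trans (g1 _).
  by apply: l2norm_gint_ge1; [exact: unimod_col_gint|exact: unimod_col_neq0].
- move=> j jn; rewrite (yE j jn); have lemu := muP (Ordinal jn); split.
  + exact: le_trans (g1 _) lemu.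
  + exact: le_trans (g2 _) lemu.
  + by apply: le_trans (g3 _) _; rewrite ler_pM2l.
- by rewrite -detg.
Qed.

End Projections.

(** * Independent pairs *)

Section DominantPair.
Variables (K : realType) (m n p : nat) (A : 'I_p -> 'M[K[i]]_(m, n)).
Local Notation C := K[i].
Local Notation nc := (@Normc.normc K).

Lemma sesqui_dotcv (B : 'M[C]_(m, n)) x y :
  (x ^t* *m B *m y) 0 0 = dotcv (B *m y) x.
Proof. by rewrite -mulmxA dotcvE. Qed.

(** By modularity of dimension, the two new pairs have together the same total dimension as the two
    given ones. *)
Lemma indep_uncross L L' R R' : indep A L R -> indep A L' R' ->
  indep A (L + L')%VS (R :&: R')%VS /\ indep A (L :&: L')%VS (R + R')%VS.
Proof.
move=> LR LR'; split=> i x y.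
  case/memv_addP=> u uL [v vL' ->]; rewrite memv_cap => /andP[yR yR'].
  by rewrite sesqui_dotcv dotcvDr -!sesqui_dotcv LR // LR' // addr0.
rewrite memv_cap => /andP[xL xL'] /memv_addP[u uR [v vR' ->]].
by rewrite sesqui_dotcv mulmxDr dotcvDl -!sesqui_dotcv LR // LR' // addr0.
Qed.

Lemma indep_full0 : indep A fullv 0%VS.
Proof.
by move=> i x y _; rewrite memv0 => /eqP ->; rewrite mulmx0 mxE.
Qed.

Variables (Ls : {vspace 'cV[C]_m}) (Rs : {vspace 'cV[C]_n}).
Hypothesis dom : dominant A Ls Rs.

Lemma dominant_ge_m : (m <= \dim Ls + \dim Rs)%N.
Proof.
have [[_ max] _ _] := dom.
by have := max _ _ indep_full0; rewrite dim_cV dimv0 addn0.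
Qed.

(** Uncrossing two pairs of maximal size gives two pairs of maximal size; minimality of [Rs] then
    applies to [Rs :&: R]. *)
Lemma dominant_min L R : indep A L R ->
  (\dim L + \dim R = \dim Ls + \dim Rs)%N -> (Rs <= R)%VS.
Proof.
move=> LR dimLR; have [[LRs max] _ minR] := dom.
have [i1 i2] := indep_uncross LRs LR.
have dL := dimv_sum_cap Ls L; have dR := dimv_sum_cap Rs R.
have m1 := max _ _ i1; have m2 := max _ _ i2.
have {}i1 : max_indep A (Ls + L)%VS (Rs :&: R)%VS.
  split=> // L' R' /max /leq_trans; apply.
  by rewrite -(leq_add2r (\dim (Ls :&: L) + \dim (Rs + R))); lia.
by apply/capv_idPl; apply: minR i1 _; exact: capvSl.
Qed.

(** A list rather than its span, so that independent integral vectors can be picked from it by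
    [free_transversal]. *)
Definition images (y : nat -> 'cV[C]_n) j : seq 'cV[C]_m :=
  [seq A i *m y l | i <- enum 'I_p, l <- iota 0 j].

Lemma imagesP y j v :
  reflect (exists i l, (l < j)%N /\ v = A i *m y l) (v \in images y j).
Proof.
apply: (iffP allpairsP) => [[[i l] /= [_ + ->]]|[i [l [lj ->]]]].
  by rewrite mem_iota => lj; exists i, l.
by exists (i, l); rewrite /= mem_enum mem_iota.
Qed.

Lemma indep_images y j :
  indep A (orthcompl <<images y j>>%VS) <<mkseq y j>>%VS.
Proof.
move=> i x v /mem_orthcompl xV vY; rewrite sesqui_dotcv.
rewrite dotcv_conj xV ?conjC0 //.
have [c ->] := mem_span_colsmx vY; rewrite colsmx_mul mulmx_sumr.
apply: memv_suml => l _; rewrite -scalemxAr; apply: memvZ; apply: memv_span.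
by apply/imagesP; exists i, l.
Qed.

(** Maximality tested on the pair of [indep_images]. The number [b] is the excess of the maximal
    dimension sum over [m]. *)
Lemma images_dim y j b : free (mkseq y j) -> (\dim Ls + \dim Rs = m + b)%N ->
  (j <= \dim <<images y j>> + b)%N.
Proof.
move=> yfree sE; have [[_ max] _ _] := dom.
have := max _ _ (@indep_images y j).
have dimY : \dim <<mkseq y j>> = j by move: yfree;
  rewrite /free size_mkseq => /eqP.
have := dim_orthcompl <<images y j>>%VS; rewrite dimY sE.
have arith (a c : nat) : (a + c = m -> c + j <= m + b -> j <= a + b)%N by lia.
exact: arith.
Qed.

(** Equality in [images_dim] would give the pair of [indep_images] maximal size, and [dominant_min]
    would put [Rs] inside the span. *)
Lemma images_dim_lt y j b : free (mkseq y j) -> (\dim Ls + \dim Rs = m + b)%N ->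
  ~~ (Rs <= <<mkseq y j>>)%VS -> (j < \dim <<images y j>> + b)%N.
Proof.
move=> yfree sE nRs; rewrite ltn_neqAle images_dim // andbT.
apply: contra nRs => /eqP jE; apply: (dominant_min (@indep_images y j)).
have dimY : \dim <<mkseq y j>> = j by move: yfree;
  rewrite /free size_mkseq => /eqP.
have := dim_orthcompl <<images y j>>%VS; rewrite dimY sE.
have arith (a c : nat) : (a + c = m -> j = a + b -> c + j = m + b)%N by lia.
by move/arith; apply.
Qed.

End DominantPair.

(** By linearity, independence for the [A i] is independence for their span. The bound [sle] places
    the dominant pair in the range of the maximum and keeps the subtraction from truncating. *)
Lemma dominant_ncrank (K : realType) m n p (A : 'I_p -> 'M[K[i]]_(m, n)) Ls Rs :
  dominant A Ls Rs ->
  (ncrank <<codom A>>%VS + (\dim Ls + \dim Rs) = m + n)%N.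
Proof.
move=> [[LRs max] _ _].
have spanE L R : indep_space <<codom A>>%VS L R <-> indep A L R.
  split=> [ind i x y xL yR|ind B x y Bs xL yR].
    by apply: ind => //; apply: memv_span; apply: codom_f.
  rewrite (coord_span (X := in_tuple (codom A)) Bs) mulmx_sumr mulmx_suml
    summxE.
  apply: big1 => j _; rewrite -scalemxAr -scalemxAl mxE.
  have /codomP[i ->] : (in_tuple (codom A))`_j \in codom A by apply: mem_nth.
  by rewrite ind ?mulr0.
have sle : (\dim Ls + \dim Rs <= m + n)%N by rewrite leq_add ?dim_le_m.
rewrite /ncrank; set M := \max_(s < _ | _) _.
suff -> : M = (\dim Ls + \dim Rs)%N by rewrite subnK.
apply/eqP; rewrite eqn_leq; apply/andP; split.
  apply/bigmax_leqP => s /asboolP[L [R [/spanE/max + <-]]] //.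
have sP : (\dim Ls + \dim Rs < (m + n).+1)%N by [].
apply: (@leq_bigmax_cond _ _ _ (Ordinal sP)).
by apply/asboolP; exists Ls, Rs; split=> //; apply/spanE.
Qed.

(** * The reduced basis against an approximately independent pair *)

Lemma prod_uniq_le (K : realType) n (mu : nat -> K) s :
    (forall j, (j < n)%N -> 1 <= mu j) -> uniq s -> {subset s <= iota 0 n} ->
  \prod_(j <- s) mu j <= \prod_(j < n) mu j.
Proof.
move=> mu1 us sn; rewrite -(big_mkord xpredT mu) /index_iota subn0.
rewrite [leRHS](bigID (mem s)) /=.
have -> : \prod_(j <- iota 0 n | j \in s) mu j = \prod_(j <- s) mu j.
  rewrite -big_filter; apply: perm_big; apply: uniq_perm;
    rewrite ?filter_uniq ?iota_uniq // => j.
  rewrite mem_filter /=; case sj: (j \in s); last by [].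
  by rewrite (sn _ sj).
rewrite ler_peMr //.
  rewrite big_seq; apply: prodr_ge0 => j /sn; rewrite mem_iota => /mu1.
  exact: le_trans ler01.
rewrite big_seq_cond; elim/big_ind: _ => // [x z x1 z1|j /andP[]].
  by rewrite mulr_ege1.
by rewrite mem_iota => jn _; apply: mu1.
Qed.

(** Separates the [mu] that enter a Gram volume, at the indices [tau i], from those left over in
    [t]; all omitted factors are at least 1. *)
Lemma prod_unused_le (K : realType) n k (mu : nat -> K) (tau : nat -> nat) t :
    (forall j, (j < n)%N -> 1 <= mu j) ->
    (forall i, (i < k)%N -> (tau i < n)%N) -> injective tau ->
    uniq t -> (forall h, h \in t -> (h < n)%N /\ forall i, tau i != h) ->
  \prod_(i < k) mu (tau i) * \prod_(h <- t) mu h <= \prod_(j < n) mu j.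
Proof.
move=> mu1 tn tinj ut th.
have -> : \prod_(i < k) mu (tau i) * \prod_(h <- t) mu h =
    \prod_(j <- map tau (iota 0 k) ++ t) mu j.
  by rewrite big_cat big_map -(big_mkord xpredT (fun i =>
    mu (tau i))) /index_iota subn0.
apply: prod_uniq_le => // [|j].
  rewrite cat_uniq (map_inj_uniq tinj) iota_uniq ut andbT /=.
  by apply/hasPn => h /th[_ tauh]; apply/negP => /mapP[i _ hE]; move: (tauh i);
    rewrite hE eqxx.
rewrite mem_cat mem_iota => /orP[/mapP[l]|/th[]//].
by rewrite mem_iota => /tn ltn_l ->.
Qed.

Lemma le_of_sqr_le_mul (K : realType) (t a : K) :
  0 <= t -> 0 <= a -> t ^+ 2 <= a * t -> t <= a.
Proof.
move=> t0 a0; have [->//|tn0] := eqVneq t 0.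
by rewrite expr2 ler_pM2r // lt0r tn0.
Qed.

Section Core.
Variables (K : realType) (m n p : nat) (A : 'I_p -> 'M[K[i]]_(m, n)).
Local Notation C := K[i].
Local Notation nc := (@Normc.normc K).
Variables (Ls L : {vspace 'cV[C]_m}) (Rs R : {vspace 'cV[C]_n}) (B eps : K) (b
  e : nat).
Hypothesis Ag : forall i, A i \is a mxOver (gint K).
Hypothesis B1 : 1 <= B.
Hypothesis AB : forall i x y, nc (dotcv (A i *m y) x) <= B * l2norm x * l2norm
  y.
Hypothesis eps0 : 0 < eps.
Hypothesis Leps : eps_indep A eps L R.
Hypothesis dom : dominant A Ls Rs.
Hypothesis sE : (\dim Ls + \dim Rs = m + b)%N.
Hypothesis dimLR : (\dim L + \dim R = m + b + e)%N.

Variables (y : nat -> 'cV[C]_n) (mu : nat -> K).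
Hypothesis yfree : free (mkseq y n).
Hypothesis yg : forall j, (j < n)%N -> y j \is a mxOver (gint K).
Hypothesis mu_mono : forall i j, (i <= j < n)%N -> mu i <= mu j.
Hypothesis mu1 : forall j, (j < n)%N -> 1 <= mu j.
Hypothesis y_mu : forall j, (j < n)%N -> [/\ l2norm (y j) <= mu j,
          l2norm (orthproj R (y j)) <= mu j
        & l2norm (y j - orthproj R (y j)) <= eps * mu j].
Hypothesis mu_prod :
  \prod_(j < n) mu j <= 2 ^+ 'C(n, 2) * eps^-1 ^+ (n - \dim R).

(** The factor [n! (2B)^n] bounds the Leibniz expansion for images of the basis; the power of 2 is
    the loss in lattice reduction. *)
Definition qconst : K := n`!%:R * (2 * B) ^+ n * 2 ^+ 'C(n, 2).

Lemma B2_ge1 : 1 <= 2 * B.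
Proof. by rewrite mulr_ege1 ?ler1n. Qed.

(** The slack 2 makes the constant agree with that of [image_small], so that their powers
    combine. *)
Lemma image_bound i l x : (l < n)%N ->
  nc (dotcv (A i *m y l) x) <= 2 * B * l2norm x * mu l.
Proof.
move=> ln; have [ymu _ _] := y_mu ln; apply: le_trans (AB i x (y l)) _.
have x0 := l2norm_ge0 x.
have B0 : 0 <= B by exact: le_trans ler01 B1.
apply: ler_pM; rewrite ?mulr_ge0 ?l2norm_ge0 //.
by rewrite -mulrA ler_peMl ?ler1n ?mulr_ge0.
Qed.

(** The part of [y l] in [R] is controlled by eps-independence, the transversal part by its length
    [eps * mu l]; together they cost [1 + B <= 2 * B]. *)
Lemma image_small i l x : (l < n)%N -> x \in L ->
  nc (dotcv (A i *m y l) x) <= 2 * B * eps * l2norm x * mu l.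
Proof.
move=> ln xL; have [_ yR yR'] := y_mu ln.
have -> : A i *m y l = A i *m orthproj R (y l) + A i *m (y l - orthproj R (y
  l)).
  by rewrite -mulmxDr addrC subrK.
rewrite dotcvDl; apply: le_trans (le_normcD _ _) _.
have h1 : nc (dotcv (A i *m orthproj R (y l)) x) <= eps * l2norm x * mu l.
  rewrite -sesqui_dotcv; apply: le_trans (Leps i xL (orthproj_mem _ _)) _.
  by rewrite ler_wpM2l // mulr_ge0 ?l2norm_ge0 // ltW.
have h2 : nc (dotcv (A i *m (y l - orthproj R (y l))) x) <= B * l2norm x * (eps
  * mu l).
  apply: le_trans (AB _ _ _) _; apply: ler_wpM2l => //.
  by rewrite mulr_ge0 ?l2norm_ge0 // (le_trans ler01).
apply: le_trans (lerD h1 h2) _.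
have -> : eps * l2norm x * mu l + B * l2norm x * (eps * mu l) =
  (1 + B) * (eps * l2norm x * mu l) by ring.
have -> : 2 * B * eps * l2norm x * mu l = (2 * B) * (eps * l2norm x * mu l) by
  ring.
have B2 : 1 + B <= 2 * B by rewrite mulr_natl mulr2n lerD2r.
apply: ler_wpM2r => //.
by rewrite !mulr_ge0 ?l2norm_ge0 // ?ltW // (lt_le_trans ltr01) // mu1.
Qed.

Lemma free_prefix j : (j <= n)%N -> free (mkseq y j).
Proof.
move=> jn; have := yfree; rewrite /mkseq -[X in iota 0 X](subnKC jn).
by rewrite iotaD map_cat; apply: catl_free.
Qed.

(* The Gram volume of n - b independent images is at least 1; comparing it
   with the product of all mu_j bounds the mu_j that were not used. *)
Lemma unused_bound (tau : nat -> nat) (X : K) :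
    (forall i, (i < n - b)%N ->
       (tau i < n)%N /\ (i < \dim <<images A y (tau i).+1>>)%N) ->
    \prod_(i < n - b) mu (tau i) * X <= \prod_(j < n) mu j -> 0 <= X ->
  X <= qconst * eps ^+ e.
Proof.
move=> tauP Xle X0.
have [|z zfree zS] := @free_transversal K m (n - b) (fun i =>
  images A y (tau i).+1).
  by move=> i /tauP[].
have zE i : (i < n - b)%N -> exists i' l, [/\ (l < n)%N,
  mu l <= mu (tau i) & z i = A i' *m y l].
  move=> ilt; have [tn _] := tauP i ilt;
    have /imagesP[i' [l [lt ->]]] := zS i ilt.
  by exists i', l; split=> //; [exact: leq_trans tn|apply: mu_mono;
    rewrite -ltnS lt].
have zg i : (i < n - b)%N -> z i \is a mxOver (gint K).
  by move=> /zE[i' [l [ln _ ->]]]; rewrite mxOverM ?Ag ?yg.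
have Lm := dim_le_m L; have Rn := dim_le_m R.
have bn : (b <= n)%N.
  have := dim_le_m Ls; have := dim_le_m Rs; move: sE.
  have arith (u v : nat) : (u + v = m + b -> v <= n -> u <= m ->
    b <= n)%N by lia.
  exact: arith.
(* This is [\dim L + (n - b) - m], a lower bound for the dimension in which [L] meets the span of
   the [z i]; each such direction yields a factor [eps]. *)
pose q := (n - \dim R + e)%N.
have qk : (q <= n - b)%N.
  move: dimLR Lm Rn; rewrite /q.
  have arith (u v : nat) : (u + v = m + b + e -> u <= m -> v <= n ->
    n - v + e <= n - b)%N by lia.
  exact: arith.
have qS : (q + m <= \dim L + (n - b))%N.
  move: dimLR Lm Rn bn; rewrite /q.
  have arith (u v : nat) : (u + v = m + b + e -> u <= m -> v <= n -> b <= n ->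
    n - v + e + m <= u + (n - b))%N by lia.
  exact: arith.
have B0 : 0 <= 2 * B by exact: le_trans ler01 B2_ge1.
have Be0 : 0 <= 2 * B * eps by rewrite mulr_ge0 // ltW.
have zL j x : (j < n - b)%N -> x \in L ->
    nc (dotcv (z j) x) <= 2 * B * eps * l2norm x * mu (tau j).
  move=> jk xL; have [i' [l [ln lmu ->]]] := zE j jk.
  by apply: le_trans (image_small i' ln xL) _;
    rewrite ler_wpM2l // mulr_ge0 ?l2norm_ge0.
have zB j x : (j < n - b)%N ->
  nc (dotcv (z j) x) <= 2 * B * l2norm x * mu (tau j).
  move=> jk; have [i' [l [ln lmu ->]]] := zE j jk.
  by apply: le_trans (image_bound i' x ln) _;
    rewrite ler_wpM2l // mulr_ge0 ?l2norm_ge0.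
have := gint_volume zg zfree qk qS zL zB.
set P := \prod_(i < _) _ in Xle *.
have -> : (2 * B * eps) ^+ q * (2 * B) ^+ (n - b - q) = (2 * B) ^+ (n - b) *
  eps ^+ q.
  by rewrite exprMn mulrAC -exprD subnKC.
set F := _%:R * _ => /(ler_wpM2r X0); rewrite mul1r -mulrA => /le_trans; apply.
have F0 : 0 <= F by rewrite !mulr_ge0 ?ler0n ?exprn_ge0 // ltW.
apply: (@le_trans _ _ (F * (2 ^+ 'C(n, 2) * eps^-1 ^+ (n - \dim R)))).
  by rewrite ler_wpM2l // (le_trans Xle).
(* The power of [eps^-1] from the lattice volume cancels all of [eps ^+ q] except [eps ^+ e]. *)
have -> : F * (2 ^+ 'C(n, 2) * eps^-1 ^+ (n - \dim R)) =
    (n - b)`!%:R * (2 * B) ^+ (n - b) * 2 ^+ 'C(n, 2) * eps ^+ e.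
  have u0 : eps ^+ (n - \dim R) != 0 by rewrite expf_neq0 // gt_eqF.
  rewrite /F /q exprD exprVn -[RHS]mulr1 -(divff u0).
  have arith (u v x1 x2 x3 : K) :
      x1 * (x2 * (u * v)) * (x3 * u^-1) = x1 * x2 * x3 * v * (u / u) by ring.
  exact: arith.
rewrite /qconst; apply: ler_wpM2r; first by rewrite exprn_ge0 // ltW.
apply: ler_wpM2r; first by rewrite exprn_ge0.
apply: ler_pM; rewrite ?ler0n ?exprn_ge0 //.
  by rewrite ler_nat leq_fact // leq_subr.
by rewrite ler_weXn2l ?leq_subr ?B2_ge1.
Qed.

(** * Small [eps]: exact dimensions and integral bases *)

Hypothesis eps1 : eps <= 1.
Hypothesis n_gt0 : (0 < n)%N.

Lemma qconst_ge1 : 1 <= qconst.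
Proof.
rewrite /qconst !mulr_ege1 ?exprn_ege1 ?ler1n ?fact_gt0 ?B2_ge1 //.
Qed.

(** With [E = 2 * B * qconst]: at most [n] terms, each a Cramer coefficient of size at most
    [n! E^(n-1)] times an error of size at most [eps * E]. *)
Definition close_const : K := n%:R * n`!%:R * (2 * B * qconst) ^+ n * eps.

Hypothesis close12 : close_const <= 1 / 2.

Lemma fact_qconst_lt1 : n`!%:R * qconst ^+ n * eps < 1.
Proof.
suff le_close : n`!%:R * qconst ^+ n * eps <= close_const.
  by apply: le_lt_trans (le_trans _ close12) _;
    rewrite // ltr_pdivrMr ?mul1r ?ltr1n.
have q1 := qconst_ge1; have q0 : 0 <= qconst by exact: le_trans ler01 q1.
rewrite /close_const -(mulrA n%:R) -(mulrA n%:R).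
apply: (@le_trans _ _ (1 * (n`!%:R * (2 * B * qconst) ^+ n * eps))).
  rewrite mul1r; apply: ler_wpM2r; first exact: ltW.
  apply: ler_wpM2l; first exact: ler0n.
  have le_q : qconst <= 2 * B * qconst by rewrite ler_peMl ?B2_ge1.
  by apply: lerXn2r; rewrite ?nnegrE // (le_trans q0).
have B0 : 0 <= B by exact: le_trans ler01 B1.
apply: ler_wpM2r; last by rewrite ler1n.
apply: mulr_ge0; last exact: ltW.
by apply: mulr_ge0; rewrite ?ler0n ?exprn_ge0 // mulr_ge0 // mulr_ge0.
Qed.

(** Here [e] is the excess of the approximate pair over the maximum. Taking [tau i = i + b] and
    [X = 1] in [unused_bound] gives [1 <= qconst * eps ^+ e], impossible for positive [e] since
    [qconst * eps < 1]. *)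
Lemma excess0 : e = 0%N.
Proof.
case: (posnP e) => // e_gt0; exfalso.
have addb_lt i : (i < n - b)%N -> (i + b < n)%N by rewrite addnC -ltn_subRL.
have tauP i : (i < n - b)%N ->
    (i + b < n)%N /\ (i < \dim <<images A y (i + b).+1>>)%N.
  move=> /addb_lt ibn; split=> //; rewrite -(ltn_add2r b).
  by have := images_dim dom (free_prefix ibn) sE.
have := @prod_unused_le K n (n - b) mu (fun i =>
  (i + b)%N) [::] mu1 addb_lt (@addIn b).
rewrite big_nil => /(_ isT (fun _ => ltac:(by []))).
move=> /(unused_bound tauP)/(_ ler01).
have := fact_qconst_lt1; have := qconst_ge1 => q1 small.
have q0 := le_trans ler01 q1.
apply/negP; rewrite -ltNge; apply: le_lt_trans small.
rewrite -(prednK e_gt0) exprS mulrA -[leRHS]mulr1.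
have e0 := ltW eps0.
apply: ler_pM; [exact: mulr_ge0|exact: exprn_ge0| |exact: exprn_ile1].
apply: ler_wpM2r => //.
rewrite -[leLHS]mul1r ler_pM ?ler1n ?fact_gt0 // -[leLHS]expr1.
exact: ler_weXn2l.
Qed.

(** The strict dimension bound up to [h] allows enough independent images to be chosen with index
    [h] skipped; [unused_bound] then applies with [X = mu h]. *)
Lemma mu_le_qconst h : (h < n)%N ->
    (forall j, (j <= h)%N -> ~~ (Rs <= <<mkseq y j>>)%VS) ->
  mu h <= qconst.
Proof.
move=> hn nRs.
(* At [j = 0] the strict bound reads [0 < 0 + b]. *)
have b_gt0 : (0 < b)%N.
  have := images_dim_lt dom (free_prefix (leq0n n)) sE (nRs 0%N (leq0n h)).
  suff -> : <<images A y 0>>%VS = 0%VS by rewrite dimv0.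
  rewrite (_ : images A y 0 = [::]) ?span_nil //.
  by rewrite /images; elim: (enum _).
(* If [i + b.-1] is at least [h], this is [i + b] as in [excess0]; otherwise it is [i + b.-1], and
   the strictness of [images_dim_lt] makes up for the missing 1. *)
pose tau i := bump h (i + b.-1).
have tau_lt i : (i < n - b)%N -> (tau i < n)%N.
  rewrite /tau /bump; case: (leqP h) => _; have := b_gt0; lia.
have tauP i : (i < n - b)%N ->
    (tau i < n)%N /\ (i < \dim <<images A y (tau i).+1>>)%N.
  move=> ilt; split; first exact: tau_lt.
  have jn := tau_lt i ilt; rewrite -(ltn_add2r b).
  have := images_dim dom (free_prefix jn) sE.
  have := @images_dim_lt _ _ _ _ _ _ _ dom y (tau i).+1 b (free_prefix jn) sE.
  move: (\dim <<images _ _ _>>) => d.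
  rewrite /tau /bump; case: (leqP h) => hi; last first.
    move=> /(_ (nRs _ _)) lt_d _; move: (lt_d hi); have := b_gt0.
    rewrite add0n; have arith (u v : nat) : ((u + v.-1).+1 < d + v -> 0 < v ->
      u + v < d + v)%N by lia.
    by move=> b0 /arith; apply.
  move=> _; have := b_gt0.
  have arith (u v : nat) : (0 < v -> (1 + (u + v.-1)).+1 <= d + v ->
    u + v < d + v)%N by lia.
  exact: arith.
have tau_inj : injective tau by move=> i j /(can_inj (bumpK h))/addIn.
have := @prod_unused_le K n (n - b) mu tau [:: h] mu1 tau_lt tau_inj isT.
rewrite big_seq1 => /(_ _)/(unused_bound tauP) le_q.
apply: le_trans (le_q _ _) _.
- by move=> l; rewrite inE => /eqP ->; split=> // i; rewrite eq_sym neq_bump.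
- by apply: le_trans ler01 _; exact: mu1.
by rewrite ler_piMr ?exprn_ile1 ?(ltW eps0) // (le_trans ler01) ?qconst_ge1.
Qed.

(* Otherwise k > dim R Gaussian-integer vectors of norm at most qconst would
   lie within eps * qconst of R, and their Gram volume would be below 1. *)
Lemma dim_R_ge k : (k <= n)%N -> (forall j, (j < k)%N -> mu j <= qconst) ->
  (k <= \dim R)%N.
Proof.
move=> kn muk; rewrite leqNgt; apply/negP => Rk.
have q0 : 0 <= qconst by exact: le_trans ler01 qconst_ge1.
have yk j : (j < k)%N -> y j \is a mxOver (gint K) by move=> jk;
  rewrite yg ?(leq_trans jk).
have k_gt0 : (0 < k)%N by exact: leq_ltn_trans Rk.
have dimS : (1 + n <= \dim (orthcompl R) + k)%N.
  have := dim_orthcompl R; move: Rk.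
  have arith (u v : nat) : (u < k -> u + v = n -> 1 + n <= v + k)%N by lia.
  exact: arith.
have yS j x : (j < k)%N -> x \in orthcompl R ->
    nc (dotcv (y j) x) <= eps * l2norm x * qconst.
  move=> jk /mem_orthcompl xR; have [_ _ yR'] := y_mu (leq_trans jk kn).
  have -> : dotcv (y j) x = dotcv (y j - orthproj R (y j)) x.
    by rewrite dotcvBl [X in _ - X]dotcv_conj xR ?orthproj_mem // conjC0 subr0.
  apply: le_trans (l2norm_CS _ _) _; rewrite mulrAC ler_wpM2r ?l2norm_ge0 //.
  by apply: le_trans yR' _; rewrite ler_pM2l ?muk.
have yB j x : (j < k)%N -> nc (dotcv (y j) x) <= 1 * l2norm x * qconst.
  move=> jk; have [ymu _ _] := y_mu (leq_trans jk kn).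
  apply: le_trans (l2norm_CS _ _) _;
    rewrite mul1r mulrC ler_wpM2l ?l2norm_ge0 //.
  exact: le_trans ymu (muk j jk).
(* One frame vector orthogonal to [R], that is [q = 1], already supplies the factor [eps] that
   contradicts [fact_qconst_lt1]. *)
have := gint_volume yk (free_prefix kn) k_gt0 dimS yS yB.
apply/negP; rewrite -ltNge; apply: le_lt_trans fact_qconst_lt1.
rewrite expr1 expr1n mulr1 prodr_const card_ord mulrAC.
apply: ler_wpM2r; first exact: ltW.
apply: ler_pM; rewrite ?ler0n ?exprn_ge0 // ?ler_nat ?leq_fact //.
by apply: ler_weXn2l => //; exact: qconst_ge1.
Qed.

Lemma dim_span_y j : (j <= n)%N -> \dim <<mkseq y j>> = j.
Proof. by move/free_prefix; rewrite /free size_mkseq => /eqP. Qed.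

(** Fewer than [\dim Rs] vectors cannot span a space containing [Rs], so [mu_le_qconst] applies. *)
Lemma mu_Rs_le j : (j < \dim Rs)%N -> mu j <= qconst.
Proof.
move=> jr; apply: mu_le_qconst => [|k kj]; first exact: leq_trans (dim_le_m Rs).
have kr := leq_ltn_trans kj jr.
have kn : (k <= n)%N by exact: leq_trans (ltnW kr) (dim_le_m Rs).
by apply/negP => /dimvS; rewrite dim_span_y // leqNgt kr.
Qed.

Hypothesis tight : e = 0%N -> (\dim R <= \dim Rs)%N.

Lemma dim_R : \dim R = \dim Rs.
Proof.
apply/eqP; rewrite eqn_leq tight ?excess0 //=.
by apply: dim_R_ge => [|j]; [exact: dim_le_m|exact: mu_Rs_le].
Qed.

(** Otherwise [mu_le_qconst] would reach the index [\dim Rs] as well, and [dim_R_ge] would force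
    [\dim R] above [\dim Rs]. *)
Lemma Rs_span : Rs = <<mkseq y (\dim Rs)>>%VS.
Proof.
have rn := dim_le_m Rs.
apply/eqP; rewrite eqEdim dim_span_y // leqnn andbT; apply/negPn/negP => nRs.
have r_lt : (\dim Rs < n)%N.
  rewrite ltn_neqAle rn andbT; apply: contra nRs => /eqP rE.
  suff -> : <<mkseq y (\dim Rs)>>%VS = fullv by exact: subvf.
  by apply/eqP; rewrite eqEdim subvf dim_cV dim_span_y //= rE leqnn.
have mu_r : mu (\dim Rs) <= qconst.
  apply: mu_le_qconst => // j; rewrite leq_eqVlt => /orP[/eqP -> //|jr].
  by apply/negP => /dimvS; rewrite dim_span_y ?(leq_trans (ltnW jr)) // leqNgt
    jr.
have muP j : (j < (\dim Rs).+1)%N -> mu j <= qconst.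
  by rewrite ltnS leq_eqVlt => /orP[/eqP -> //|]; exact: mu_Rs_le.
by have := dim_R_ge r_lt muP; rewrite dim_R ltnn.
Qed.

(** Absorbs the Cramer estimates of both [close_R], with [D = D' = qconst], and [close_L], with
    [D = D' = 2 * B * qconst]. *)
Lemma close_const_ge k D D' (t : K) : (k <= n)%N -> 0 <= D ->
  D <= 2 * B * qconst ->
    0 <= D' -> D' <= 2 * B * qconst -> 0 <= t ->
  k%:R * (k`!%:R * D ^+ k.-1 * t * (eps * D')) <= close_const * t.
Proof.
move=> kn D0 DB D'0 D'B t0; rewrite /close_const;
  set E := 2 * B * qconst in DB D'B *.
have E1 : 1 <= E by rewrite mulr_ege1 ?B2_ge1 ?qconst_ge1.
have E0 : 0 <= E by exact: le_trans ler01 E1.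
have arith (a f d x z : K) : a * (f * d * x * (eps * z)) = a * f * (d * z) *
  eps * x by ring.
rewrite arith; do 2 (apply: ler_wpM2r; rewrite ?(ltW eps0) //).
(* For [k = 0] the predecessor truncates, but the left-hand side vanishes. *)
have [->|k_gt0] := posnP k.
  by rewrite !mul0r mulr_ge0 ?mulr_ge0 ?ler0n ?exprn_ge0.
apply: ler_pM; rewrite ?mulr_ge0 ?ler0n ?exprn_ge0 //.
  by rewrite -!natrM ler_nat leq_mul ?leq_fact.
apply: (@le_trans _ _ (E ^+ k)); last by apply: ler_weXn2l.
rewrite -[in leRHS](prednK k_gt0) exprSr; apply: ler_pM; rewrite ?exprn_ge0 //.
by apply: lerXn2r; rewrite ?nnegrE.
Qed.

Lemma le_2BX (x : K) : 0 <= x -> x <= 2 * B * x.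
Proof. by move=> x0; rewrite ler_peMl ?B2_ge1. Qed.

(** Expand [v] in the integral basis of [Rs]: the coefficients are bounded by [gint_coord], and each
    basis vector lies within [eps * qconst] of [R]. *)
Lemma close_R v : v \in Rs -> l2norm (v - orthproj R v) <= close_const * l2norm
  v.
Proof.
rewrite {1}Rs_span => vY; have rn := dim_le_m Rs.
have q1 := qconst_ge1; have q0 : 0 <= qconst by exact: le_trans ler01 q1.
have [j jr|j jr|c vE cP] := gint_coord (D := qconst) _ (free_prefix rn) _ vY.
- by apply: yg; exact: leq_trans jr rn.
- by have [yj _ _] := y_mu (leq_trans jr rn); apply: le_trans yj (mu_Rs_le jr).
have -> : v - orthproj R v = \sum_(j < \dim Rs) c j *: (y j - orthproj R (y j)).
  rewrite {1 2}vE linear_sum -sumrB; apply: eq_bigr => j _.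
  by rewrite linearZ scalerBr.
apply: le_trans (l2norm_sum _ _ _) _.
apply: (@le_trans _ _ (\sum_(j < \dim Rs)
    (\dim Rs)`!%:R * qconst ^+ (\dim Rs).-1 * l2norm v * (eps * qconst))).
  apply: ler_sum => j _; rewrite l2normZ; apply: ler_pM;
    rewrite ?nc_ge0 ?l2norm_ge0 ?cP //.
  have [_ _ yj] := y_mu (leq_trans (ltn_ord j) rn); apply: le_trans yj _.
  by rewrite ler_pM2l ?mu_Rs_le.
rewrite sumr_const card_ord -[X in X <= _]mulr_natl.
by apply: close_const_ge => //; [exact: le_2BX|exact: le_2BX|exact: l2norm_ge0].
Qed.

(** Since [Rs] is spanned by these [y l], their images are orthogonal to [Ls]; [images_dim] supplies
    the matching dimension. *)
Lemma images_span : <<images A y (\dim Rs)>>%VS = orthcompl Ls.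
Proof.
have rn := dim_le_m Rs; have [[LRs _] _ _] := dom.
apply/eqP; rewrite eqEdim; apply/andP; split.
  apply/span_subvP => v /imagesP[i' [l [lr ->]]]; apply/mem_orthcompl => u uL.
  rewrite -sesqui_dotcv LRs // Rs_span; apply: memv_span; exact: mem_mkseq_lt.
have := images_dim dom (free_prefix rn) sE; have := dim_orthcompl Ls; move: sE.
have arith (u v w x : nat) : (u + v = m + b -> u + w = m -> v <= x + b ->
  w <= x)%N by lia.
exact: arith.
Qed.

(** Same scheme as [close_R], with a basis of integral images. The squared norm of the projection of
    such an image to [L] is its pairing with it, so [image_small] bounds the projection itself. *)
Lemma close_L v : v \in orthcompl Ls ->
  l2norm (orthproj L v) <= close_const * l2norm v.
Proof.
have rn := dim_le_m Rs; rewrite -images_span.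
set k := \dim <<images A y (\dim Rs)>>%VS.
have q0 : 0 <= qconst by exact: le_trans ler01 qconst_ge1.
have B0 : 0 <= B by exact: le_trans ler01 B1.
have BQ0 : 0 <= 2 * B * qconst by rewrite mulr_ge0 // mulr_ge0.
have kn : (k <= n)%N.
  have := dim_orthcompl Ls; rewrite -images_span -/k; move: sE rn (dim_le_m Ls).
  have arith (u t w : nat) :
    (u + t = m + b -> t <= n -> u <= m -> u + w = m -> w <= n)%N by lia.
  exact: arith.
have [//|z zfree zS] := @free_transversal K m k (fun=> images A y (\dim Rs)).
have zE i : (i < k)%N -> exists i' l, (l < \dim Rs)%N /\ z i = A i' *m y l.
  by move=> /zS/imagesP.
have -> : <<images A y (\dim Rs)>>%VS = <<mkseq z k>>%VS.
  apply/esym/eqP; rewrite eqEdim; apply/andP; split.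
    apply/span_subvP => u /mem_mkseq_ltP[l lk ->].
    by apply: memv_span; have := zS l lk.
  by move: zfree; rewrite /free size_mkseq => /eqP ->.
move=> vz.
have zg j : (j < k)%N -> z j \is a mxOver (gint K).
  by move=> /zE[i' [l [lr ->]]]; rewrite mxOverM ?Ag ?yg // (leq_trans lr).
have zL j : (j < k)%N -> l2norm (orthproj L (z j)) <= eps * (2 * B * qconst).
  move=> /zE[i' [l [lr zjE]]].
  have ln := leq_trans lr rn; have := image_small i' ln (orthproj_mem L (z j)).
  rewrite -zjE => small; apply: (le_of_sqr_le_mul (l2norm_ge0 _) (mulr_ge0 (ltW
    eps0) BQ0)).
  have -> : l2norm (orthproj L (z j)) ^+ 2 = nc (dotcv (z j) (orthproj L (z
    j))).
    by rewrite -l2norm_orthproj_sqr nc_real ger0_norm ?sqr_ge0.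
  apply: le_trans small _; have lemu := mu_Rs_le lr.
  have -> : eps * (2 * B * qconst) * l2norm (orthproj L (z j)) =
    2 * B * eps * l2norm (orthproj L (z j)) * qconst by ring.
  by apply: ler_wpM2l => //; rewrite !mulr_ge0 ?l2norm_ge0 // ltW.
have zD j : (j < k)%N -> l2norm (z j) <= 2 * B * qconst.
  move=> /zE[i' [l [lr zjE]]].
  have ln := leq_trans lr rn; have := image_bound i' (z j) ln.
  rewrite -zjE -l2norm_dot nc_real ger0_norm ?sqr_ge0 // => bnd.
  apply: (le_of_sqr_le_mul (l2norm_ge0 _) BQ0).
  apply: le_trans bnd _; rewrite [leRHS]mulrAC.
  by apply: ler_wpM2l; rewrite ?mu_Rs_le // mulr_ge0 ?l2norm_ge0 // mulr_ge0.
have [c vE cP] := gint_coord zg zfree zD vz.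
have -> : orthproj L v = \sum_(j < k) c j *: orthproj L (z j).
  by rewrite {1}vE linear_sum; apply: eq_bigr => j _; rewrite linearZ.
apply: le_trans (l2norm_sum _ _ _) _.
apply: (@le_trans _ _ (\sum_(j < k)
    k`!%:R * (2 * B * qconst) ^+ k.-1 * l2norm v * (eps * (2 * B * qconst)))).
  apply: ler_sum => j _; rewrite l2normZ.
  by apply: ler_pM; rewrite ?nc_ge0 ?l2norm_ge0 ?cP ?zL.
rewrite sumr_const card_ord -[X in X <= _]mulr_natl.
by apply: close_const_ge => //; exact: l2norm_ge0.
Qed.

End Core.

(** * Constants *)

Lemma close_const_ge0 (K : realType) n (B eps : K) :
  0 <= B -> 0 <= eps -> 0 <= close_const n B eps.
Proof.
move=> B0 e0; have B20 : 0 <= 2 * B by exact: mulr_ge0.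
have q0 : 0 <= qconst n B.
  by apply: mulr_ge0; [apply: mulr_ge0 => //|]; exact: exprn_ge0.
apply: mulr_ge0 => //; apply: mulr_ge0; first exact: mulr_ge0.
by apply: exprn_ge0; exact: mulr_ge0.
Qed.

(** * From integral bases to close projections *)

Section Closeness.
Variables (K : realType) (m n p : nat) (A : 'I_p -> 'M[K[i]]_(m, n)).
Local Notation C := K[i].
Local Notation nc := (@Normc.normc K).

Lemma projections_close (Ls L : {vspace 'cV[C]_m}) (Rs R : {vspace 'cV[C]_n})
    (B eps : K) :
    (0 < n)%N -> (forall i, A i \is a mxOver (gint K)) -> 1 <= B ->
    (forall i x y, nc (dotcv (A i *m y) x) <= B * l2norm x * l2norm y) ->
    0 < eps -> eps <= 1 -> eps_indep A eps L R -> dominant A Ls Rs ->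
    (\dim Ls + \dim Rs <= \dim L + \dim R)%N ->
    (\dim L + \dim R = \dim Ls + \dim Rs -> \dim R <= \dim Rs)%N ->
    close_const n B eps <= 1 / 2 ->
  (forall x, l2norm (orthproj L x - orthproj Ls x) <= 3 * close_const n B eps *
    l2norm x) /\
  (forall x, l2norm (orthproj R x - orthproj Rs x) <= 3 * close_const n B eps *
    l2norm x).
Proof.
move=> n0 Ag B1 AB eps0 eps1 Leps dom dims tight half.
have [y [mu [[yfree yg] mu_mono mu1 y_mu mu_prod]]] := approx_basis R eps0 eps1.
have sE : (\dim Ls + \dim Rs = m + (\dim Ls + \dim Rs - m))%N.
  by rewrite subnKC ?(dominant_ge_m dom).
have dimLR : (\dim L + \dim R = m + (\dim Ls + \dim Rs - m) +
    (\dim L + \dim R - (\dim Ls + \dim Rs)))%N by rewrite -sE subnKC.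
have e0 := excess0 Ag B1 AB eps0 Leps dom sE dimLR yfree yg mu_mono mu1 y_mu
  mu_prod eps1 n0 half.
have tight' : (\dim L + \dim R - (\dim Ls + \dim Rs) = 0 ->
  \dim R <= \dim Rs)%N.
  by move=> _; apply: tight; rewrite sE dimLR e0 addn0.
have dR := dim_R Ag B1 AB eps0 Leps dom sE dimLR yfree yg mu_mono mu1 y_mu
  mu_prod eps1 n0 half tight'.
have cR := close_R Ag B1 AB eps0 Leps dom sE dimLR yfree yg mu_mono mu1 y_mu
  mu_prod eps1 n0 half tight'.
have cL := close_L Ag B1 AB eps0 Leps dom sE dimLR yfree yg mu_mono mu1 y_mu
  mu_prod eps1 n0 half tight'.
have d0 := close_const_ge0 n (le_trans ler01 B1) (ltW eps0).
split=> x; last exact: (@orthproj_close _ _ Rs R).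
have dL : \dim (orthcompl Ls) = \dim (orthcompl L).
  have := dim_orthcompl Ls; have := dim_orthcompl L; move: sE dimLR;
    rewrite e0 dR.
  have arith (u v w t r c : nat) : (u + r = m + c -> v + r = m + c + 0 ->
    v + w = m ->
    u + t = m -> t = w)%N by lia.
  exact: arith.
(* For [L] the comparison is made between the complements: a vector almost orthogonal to [L] is
   close to [orthcompl L]. *)
rewrite orthprojB_orthcompl l2normN; apply: orthproj_close => // v vLs.
by rewrite orthproj_orthcompl_sub; exact: cL.
Qed.

Lemma dotcv_entry_bound (B : 'M[C]_(m, n)) (M : K) x y :
    (forall a b, nc (B a b) <= M) ->
  nc (dotcv (B *m y) x) <= m%:R * n%:R * M * l2norm x * l2norm y.
Proof.
move=> BM; rewrite dotcvE mxE; apply: le_trans (nc_sum _ _ _) _.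
apply: (@le_trans _ _ (\sum_(a < m) n%:R * M * l2norm x * l2norm y));
  last first.
  by rewrite sumr_const card_ord -[X in X <= _]mulr_natl !mulrA.
apply: ler_sum => a _; rewrite Normc.normcM !mxE nc_conj.
apply: (@le_trans _ _ (l2norm x * \sum_(b < n) M * l2norm y)); last first.
  rewrite sumr_const card_ord -[X in _ * X <= _]mulr_natl.
  by rewrite mulrC !mulrA mulrAC.
apply: ler_pM; rewrite ?nc_ge0 ?l2norm_coord //.
apply: le_trans (nc_sum _ _ _) _; apply: ler_sum => b _.
by rewrite Normc.normcM; apply: ler_pM; rewrite ?nc_ge0 ?l2norm_coord.
Qed.

End Closeness.

(** Every factor is replaced by a power of [N = m + n >= 2], using [n! <= N^n] and
    [2 * B <= N^3 * M]; [expN] and [expM] collect the exponents. The 4 lets a bound below 2 imply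
    [close_const < 1 / 2] and also covers the 3 of [orthproj_close]. *)
Lemma close_const_le (K : realType) (m n : nat) (M eps : K) :
    (0 < m)%N -> (0 < n)%N -> 1 <= M -> 0 <= eps ->
  4 * close_const n (m%:R * n%:R * M) eps <=
    (m + n)%:R ^+ (12 * n ^ 2 * (n + m)) * M ^+ (12 * n ^ 2) * eps.
Proof.
move=> m0 n0; have nn : (n <= n * n)%N by rewrite leq_pmulr.
have nnm : (n * n <= n * n * m)%N by rewrite leq_pmulr.
have expN : (3 + n + (3 + (4 * n + n ^ 2)) * n <= 12 * n ^ 2 * (n + m))%N.
  by rewrite -mulnn; lia.
have expM : (n.+1 * n <= 12 * n ^ 2)%N by rewrite -mulnn; lia.
move=> M1 e0; pose N : K := (m + n)%:R.
have N2 : 2 <= N by rewrite /N (ler_nat K 2); lia.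
have N1 : 1 <= N by rewrite (le_trans _ N2) // ler1n.
have N0 : 0 <= N by rewrite (le_trans ler01).
have M0 : 0 <= M by rewrite (le_trans ler01).
have mN : m%:R <= N by rewrite ler_nat; lia.
have nN : n%:R <= N by rewrite ler_nat; lia.
have facN : n`!%:R <= N ^+ n.
  rewrite /N -natrX ler_nat.
  elim: {1 3 5}n (leq_addl m n) => // k IHk kN.
  by rewrite factS expnS leq_mul // IHk // ltnW.
set B := m%:R * n%:R * M.
have B0 : 0 <= 2 * B by rewrite !mulr_ge0 ?ler0n.
have BN : 2 * B <= N ^+ 3 * M.
  rewrite /B !mulrA; apply: ler_wpM2r => //; rewrite !exprS expr0 mulr1 mulrA.
  by rewrite !ler_pM ?mulr_ge0 ?ler0n.
have q0 : 0 <= qconst n B.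
  by apply: mulr_ge0; [apply: mulr_ge0 => //|]; exact: exprn_ge0.
have QN : qconst n B <= N ^+ (4 * n + n ^ 2) * M ^+ n.
  have -> : N ^+ (4 * n + n ^ 2) * M ^+ n = N ^+ n * (N ^+ 3 * M) ^+ n * N ^+
    (n ^ 2).
    rewrite exprMn -exprM [RHS]mulrAC mulrA -!exprD; congr (N ^+ _ * _).
    by clear; lia.
  rewrite /qconst; apply: ler_pM; rewrite ?mulr_ge0 ?exprn_ge0 ?ler0n //.
    apply: ler_pM; rewrite ?exprn_ge0 ?ler0n //.
    by apply: lerXn2r; rewrite ?nnegrE ?(le_trans B0).
  apply: (@le_trans _ _ (N ^+ 'C(n, 2))).
    by apply: lerXn2r; rewrite ?nnegrE.
  apply: ler_weXn2l => //; rewrite bin2 -divn2 -mulnn.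
  by apply: leq_trans (leq_div _ _) _; rewrite leq_mul2l leq_pred orbT.
have BQN : 2 * B * qconst n B <= N ^+ (3 + (4 * n + n ^ 2)) * M ^+ n.+1.
  have -> : N ^+ (3 + (4 * n + n ^ 2)) * M ^+ n.+1 =
    (N ^+ 3 * M) * (N ^+ (4 * n + n ^ 2) * M ^+ n) by rewrite exprD (exprS M)
      mulrACA.
  exact: ler_pM.
have four : 4 * n%:R * n`!%:R <= N ^+ (3 + n) :> K.
  rewrite exprD; apply: ler_pM; rewrite ?mulr_ge0 ?ler0n //.
  rewrite (exprD _ 2 1) expr1; apply: ler_pM; rewrite ?ler0n //.
  have <- : 2 * 2 = 4 :> K by rewrite -natrM.
  by rewrite expr2; apply: ler_pM; rewrite ?ler0n.
apply: (@le_trans _ _ (N ^+ (3 + n) *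
    (N ^+ (3 + (4 * n + n ^ 2)) * M ^+ n.+1) ^+ n * eps)).
  rewrite /close_const -/B 3!mulrA; apply: ler_wpM2r => //.
  have bq0 := mulr_ge0 B0 q0.
  apply: ler_pM => //; [by rewrite !mulr_ge0 ?ler0n|exact: exprn_ge0|].
  by apply: lerXn2r; rewrite ?nnegrE ?(le_trans bq0 BQN).
apply: ler_wpM2r => //; rewrite exprMn -!exprM mulrA -exprD.
by apply: ler_pM; rewrite ?exprn_ge0 //; apply: ler_weXn2l.
Qed.

Lemma opnorm_orthprojB_le2 (K : realType) m (L L' : {vspace 'cV[K[i]]_m}) :
  opnorm (orthproj L - orthproj L') <= 2.
Proof.
apply: opnorm_le => // v; rewrite add_lfunE opp_lfunE.
apply: le_trans (l2normD _ _) _; rewrite l2normN mulr_natl mulr2n.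
by apply: lerD; exact: l2norm_orthproj.
Qed.

(** * Operator norms and the exceptional zero family *)

Section Conclusion.
Variables (K : realType) (m n p : nat) (A : 'I_p -> 'M[K[i]]_(m, n)) (M : K).
Local Notation C := K[i].
Variables (Ls L : {vspace 'cV[C]_m}) (Rs R : {vspace 'cV[C]_n}).
Hypothesis dom : dominant A Ls Rs.
Hypothesis dims : (\dim Ls + \dim Rs <= \dim L + \dim R)%N.
(** The pair of full spaces is then independent, so maximality and [dims] force all four spaces to
    be full. *)
Lemma trivial_family : (forall i, A i = 0) -> L = Ls /\ R = Rs.
Proof.
move=> A0; have full : indep A fullv fullv.
  by move=> i x y _ _; rewrite A0 mulmx0 mul0mx mxE.
have [[_ max] _ _] := dom; have := max _ _ full; rewrite !dim_cV => le_s.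
have fullE k (V W : {vspace 'cV[C]_k}) : \dim V = k -> \dim W = k -> V = W.
  move=> Vk Wk; have eq_full (U : {vspace 'cV[C]_k}) : \dim U = k -> U = fullv.
    by move=> Uk; apply/eqP; rewrite eqEdim subvf dim_cV Uk leqnn.
  by rewrite (eq_full V) // (eq_full W).
have arith (u v w t : nat) : (m + n <= u + v -> u + v <= w + t ->
    u <= m -> v <= n -> w <= m -> t <= n -> [/\ u = m, v = n, w = m & t = n])%N.
  by move=> h1 h2 h3 h4 h5 h6; split; lia.
have [dLs dRs dL dR] := arith _ _ _ _ le_s dims (dim_le_m Ls) (dim_le_m Rs)
  (dim_le_m L) (dim_le_m R).
by split; apply: fullE.
Qed.

Hypothesis m_gt0 : (0 < m)%N.
Hypothesis n_gt0 : (0 < n)%N.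
Hypothesis Aint :
  forall i a b, exists2 z : int, A i a b = z%:~R & `|z|%:~R <= M.
Hypothesis tight : (\dim L + \dim R = \dim Ls + \dim Rs -> \dim R <= \dim Rs)%N.

Lemma opnorm_bound (eps : K) : 1 <= M -> 0 < eps -> eps_indep A eps L R ->
  let bound := (m + n)%:R ^+ (12 * n ^ 2 * (n + m)) * M ^+ (12 * n ^ 2) * eps in
  opnorm (orthproj L - orthproj Ls) <= bound /\
  opnorm (orthproj R - orthproj Rs) <= bound.
Proof.
move=> M1 e0 Leps bound.
(* Two projections never differ by more than 2; a bound below 2 serves as the smallness assumption
   on [eps]. *)
have [b2|b2] := leP 2 bound.
  by split; apply: le_trans b2; exact: opnorm_orthprojB_le2.
have N1 : 1 <= (m + n)%:R :> K by rewrite ler1n addn_gt0 m_gt0.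
have eps_le : eps <= bound by rewrite ler_peMl ?(ltW e0) // mulr_ege1
  ?exprn_ege1.
pose B : K := m%:R * n%:R * M.
have cle : 4 * close_const n B eps <= bound :=
  close_const_le m_gt0 n_gt0 M1 (ltW e0).
clearbody bound.
have B1 : 1 <= B by rewrite /B !mulr_ege1 ?ler1n.
have c0 := close_const_ge0 n (le_trans ler01 B1) (ltW e0).
(* All factors of [close_const] other than [eps] are at least 1. *)
have eps1 : eps <= 1.
  apply: le_trans (_ : close_const n B eps <= 1); last by lra.
  rewrite /close_const ler_peMl ?(ltW e0) // mulr_ege1 ?exprn_ege1 //.
    by rewrite mulr_ege1 ?ler1n ?fact_gt0.
  by rewrite mulr_ege1 ?(qconst_ge1 n B1) // mulr_ege1 ?ler1n.
have Ag i : A i \is a mxOver (gint K).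
  by apply/mxOverP => a b; have [z -> _] := Aint i a b; exact: gint_int.
have AM i a b : Normc.normc (A i a b) <= M.
  have [z -> zM] := Aint i a b; apply: le_trans zM.
  by rewrite -[X in Normc.normc X](rmorph_int (real_complex K)) nc_real
    -intr_norm.
have AB i x y : Normc.normc (dotcv (A i *m y) x) <= B * l2norm x * l2norm y.
  exact: dotcv_entry_bound.
have half : close_const n B eps <= 1 / 2 by lra.
have [cL cR] := projections_close n_gt0 Ag B1 AB e0 eps1 Leps dom dims tight
  half.
have le3 : 3 * close_const n B eps <= bound by lra.
have bound0 : 0 <= bound by exact: le_trans (ltW e0) eps_le.
split; apply: opnorm_le => // v; rewrite add_lfunE opp_lfunE.
  by apply: le_trans (cL v) _; rewrite ler_wpM2r ?l2norm_ge0.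
by apply: le_trans (cR v) _; rewrite ler_wpM2r ?l2norm_ge0.
Qed.

Lemma entry_bound_ge1 : (exists i, A i != 0) -> 1 <= M.
Proof.
move=> [i0 Ai0]; have [/forallP A0|] :=
  boolP [forall a, [forall b, A i0 a b == 0]].
  case/eqP: Ai0; apply/matrixP => a b; rewrite mxE.
  by move/forallP: (A0 a) => /(_ b)/eqP.
rewrite negb_forall => /existsP[a]; rewrite negb_forall => /existsP[b].
have [z -> zM] := Aint i0 a b; rewrite intr_eq0 => z0; apply: le_trans zM.
by rewrite ler1z -gtz0_ge1 normr_gt0.
Qed.

End Conclusion.

Lemma expR_mul_ln (K : realType) k (x : K) : 0 < x ->
  expR (k%:R * ln x) = x ^+ k.
Proof. by move=> x0; rewrite expRM_natl lnK. Qed.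

Lemma eps_indep_mono (K : realType) m n p (A : 'I_p -> 'M[K[i]]_(m,
  n)) (e e' : K) L R :
  e <= e' -> eps_indep A e L R -> eps_indep A e' L R.
Proof.
move=> ee eLR i x y xL yR; apply: le_trans (eLR i x y xL yR) _.
by rewrite ler_wpM2r ?l2norm_ge0 // ler_wpM2r ?l2norm_ge0.
Qed.

Theorem theorem3p13 (K : realType) :
  exists c : K, 0 < c /\
  forall (m n p : nat) (A : 'I_p -> 'M[K[i]]_(m, n)) (M eps : K)
         (Ls L : {vspace 'cV[K[i]]_m}) (Rs R : {vspace 'cV[K[i]]_n}),
  (0 < m)%N -> (0 < n)%N -> (0 < p)%N -> 0 < M ->
  (forall i a b, exists2 z : int, A i a b = z%:~R & `|z|%:~R <= M) ->
  dominant A Ls Rs ->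
  0 <= eps ->
  eps_indep A eps L R ->
  violates (ncrank <<codom A>>%VS) (\dim Rs).+1 L R ->
  eps <= expR (- (c * (n%:R * (n + m)%:R * ln (m + n)%:R + n%:R * ln M))) ->
  let bound := expR (c * (n%:R ^+ 2 * (n + m)%:R * ln (m + n)%:R
                          + n%:R ^+ 2 * ln (M * p%:R))) * eps in
  opnorm (orthproj L - orthproj Ls) <= bound /\
  opnorm (orthproj R - orthproj Rs) <= bound.
Proof.
(* The value is the 12 in the exponents of [close_const_le]. *)
exists 12; split=> // m n p A M eps Ls L Rs R m0 n0 p0 M0 Aint dom eps0 Leps
  viol _ bound.
have kE := dominant_ncrank dom.
(* By [kE], the violation says that the dimension sum exceeds the maximum, or attains it with
   [\dim R] at most [\dim Rs]. *)
have dims : (\dim Ls + \dim Rs <= \dim L + \dim R)%N.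
  move: viol kE; rewrite /violates;
    move: (ncrank _) (\dim L) (\dim R) (\dim Ls) (\dim Rs).
  by move=> k u v w t; clear; lia.
have tight : (\dim L + \dim R = \dim Ls + \dim Rs -> \dim R <= \dim Rs)%N.
  move: viol kE; rewrite /violates;
    move: (ncrank _) (\dim L) (\dim R) (\dim Ls) (\dim Rs).
  by move=> k u v w t; clear; lia.
(* The zero family is treated apart, because [1 <= M] is derived from a nonzero integer entry. *)
have [/forallP A0|] := boolP [forall i, A i == 0].
  have [-> ->] := trivial_family dom dims (fun i => eqP (A0 i)).
  have bound0 : 0 <= bound by rewrite mulr_ge0 ?expR_ge0.
  by rewrite !subrr; split; apply: opnorm_le => // v;
    rewrite zero_lfunE l2norm0 mulr_ge0 ?l2norm_ge0.
rewrite negb_forall => /existsP A_neq0; have M1 := entry_bound_ge1 Aint A_neq0.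
have N0 : 0 < (m + n)%:R :> K by rewrite ltr0n addn_gt0 m0.
pose F : K := (m + n)%:R ^+ (12 * n ^ 2 * (n + m)) * M ^+ (12 * n ^ 2).
have F0 : 0 < F by rewrite mulr_gt0 ?exprn_gt0.
(* [F] is the exponential factor with [p] replaced by 1. *)
have le_bound : F * eps <= bound.
  apply: ler_wpM2r => //.
  have -> : 12 * (n%:R ^+ 2 * (n + m)%:R * ln (m + n)%:R + n%:R ^+ 2 * ln (M *
    p%:R)) =
    (12 * n ^ 2 * (n + m))%:R * ln (m + n)%:R + (12 * n ^ 2)%:R * ln (M * p%:R)
      :> K.
    by rewrite !natrM ?natrX; ring.
  have p1 : 1 <= p%:R :> K by rewrite ler1n.
  have Mp : M <= M * p%:R by rewrite ler_peMr // ltW.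
  rewrite expRD !expR_mul_ln ?(lt_le_trans M0 Mp) //.
  apply: ler_wpM2l; first by rewrite exprn_ge0 // ltW.
  by apply: lerXn2r; rewrite ?nnegrE ?(ltW M0) ?(ltW (lt_le_trans M0 Mp)).
suff main : opnorm (orthproj L - orthproj Ls) <= F * eps /\
    opnorm (orthproj R - orthproj Rs) <= F * eps.
  by split; apply: le_trans le_bound; case: main.
(* Stretching by the inverse requires a positive parameter, so the estimate is applied to every
   positive [e >= eps], and [e] then tends to [eps]. *)
have approx e : eps <= e -> 0 < e ->
  opnorm (orthproj L - orthproj Ls) <= F * e /\
    opnorm (orthproj R - orthproj Rs) <= F * e.
  move=> ee e_gt0; have Le := eps_indep_mono ee Leps.
  by apply: opnorm_bound => //; exact: dom.
have limit (x : K) : (forall e,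
  eps <= e -> 0 < e -> x <= F * e) -> x <= F * eps.
  move=> xF; apply/ler_addgt0Pr => d d0.
  have -> : F * eps + d = F * (eps + d / F) by rewrite mulrDr (mulrCA F d)
    divff ?gt_eqF // mulr1.
  by have dF : 0 < d / F := divr_gt0 d0 F0; apply: xF;
    rewrite ?lerDl ?ltr_wpDl // ltW.
by split; apply: limit => e ee e_gt0; have [] := approx e ee e_gt0.
Qed.
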